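(* Let $k$ be a field of characteristic zero, let $K\subset K^*$ be a finite separable extension of algebraic function fields over $k$, let $\nu^*$ be a valuation of $K^*$ (trivial on $k$) and let $\nu=\nu^*|_K$. Assume that $\nu^*$ is a rational $0$-dimensional valuation and that $n=\mathrm{trdeg}_kK^*-\mathrm{trdeg}_kV_{\nu^*}/m_{\nu^*}=2$. Let $R$ and $S$ be algebraic local rings of $K$ and $K^*$ such that $S$ dominates $R$ and $\nu^*$ dominates $S$, and suppose that $R\to S$ is stable. Let $e=[\Gamma_{\nu^*}:\Gamma_\nu]$ and $f=[V_{\nu^*}/m_{\nu^*}:V_\nu/m_\nu]$, and let $u,v$ be regular parameters in $R$, $x,y$ regular parameters in $S$ and $\gamma_0\in S$ a unit such that $$u=\gamma_0x^e,\qquad v=y$$ (such parameters exist because $R\to S$ is stable). Then $$ \mathrm{gr}_{\nu^*}(S)\cong \left(\mathrm{gr}_{\nu}(R)\otimes_{R/m_R}S/m_S\right)[Z]/(Z^e-[\gamma_0]^{-1}[u]), $$ where $[\gamma_0]$ is the class of $\gamma_0$ in $S/m_S$ and $[u]$ is the initial form of $u$ in $\mathrm{gr}_\nu(R)$, and the degree of the extension of quotient fields of $\mathrm{gr}_{\nu}(R)\to\mathrm{gr}_{\nu^*}(S)$ is $ef$.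
   Context: For a valuation $\nu$, $V_\nu$ is its valuation ring, $m_\nu$ the maximal ideal of $V_\nu$, $\Gamma_\nu$ its value group. $\nu$ is rational if $\Gamma_\nu$ is order isomorphic to a subgroup of $\mathbb Q$, and $0$-dimensional if $\mathrm{trdeg}_kV_\nu/m_\nu=0$. An algebraic local ring of $K$ is a local ring $R$ (maximal ideal $m_R$) which is essentially of finite type over $k$ and has quotient field $K$; $\nu$ dominates $R$ if $R\subset V_\nu$ and $m_\nu\cap R=m_R$; $S$ dominates $R$ if $R\subset S$ and $m_S\cap R=m_R$. Associated graded ring: for $\gamma\in\Gamma_\nu$, $\mathcal P_\gamma(R)=\{g\in R\mid\nu(g)\ge\gamma\}$, $\mathcal P_\gamma^+(R)=\{g\in R\mid\nu(g)>\gamma\}$, and $\mathrm{gr}_\nu(R)=\bigoplus_{\gamma\in\Gamma_\nu}\mathcal P_\gamma(R)/\mathcal P^+_\gamma(R)$. The initial form of $g\in R$ with $\nu(g)=\gamma$ is its class in $\mathcal P_\gamma(R)/\mathcal P^+_\gamma(R)$. Similarly for $\mathrm{gr}_{\nu^*}(S)$. Monoidal transform: $R\to R_1$, where $R_1$ is a local ring of the blowup of a regular prime ideal $P$ of $R$ (i.e. $R/P$ is regular); it is along $\nu$ if $V_\nu$ dominates $R_1$. Strongly monomial (for $n=2$ and $\nu^*$ rational $0$-dimensional): $R\to S$ is strongly monomial with respect to regular parameters $u,v$ in $R$ and $x,y$ in $S$ if $R,S$ are two-dimensional regular local rings and $u=\gamma_0x^t$, $v=y$ for some unit $\gamma_0\in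 S$ and positive integer $t$; its exponent matrix is $A=\begin{pmatrix}t&0\\0&1\end{pmatrix}$. $R\to S$ is strongly monomial if such parameters exist. Stable: $R\to S$ is stable if (1) $R\to S$ is strongly monomial, and (2) whenever $R\to R_1$ and $S\to S_1$ are products of monoidal transforms along $\nu$ and $\nu^*$ respectively (possibly trivial), with $S_1$ dominating $R_1$, and $R_1\to S_1$ is strongly monomial with respect to regular parameters $u_1,v_1$ in $R_1$ and $x_1,y_1$ in $S_1$, with exponent matrix $A_1$, one has: (2a) the homomorphism $\mathbb Z^2/A_1^t\mathbb Z^2\to\Gamma_{\nu^*}/\Gamma_\nu$, $(b_1,b_2)\mapsto[b_1\nu^*(x_1)+b_2\nu^*(y_1)]$, is an isomorphism ($A_1^t$ is the transpose); (2b) $V_{\nu^*}/m_{\nu^*}$ is the join $(V_\nu/m_\nu)(S_1/m_{S_1})$; (2c) $V_\nu/m_\nu$ and $S_1/m_{S_1}$ are linearly disjoint over $R_1/m_{R_1}$ in $V_{\nu^*}/m_{\nu^*}$. *)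

(* Defs.v *)
From HB Require Import structures.
From mathcomp Require Import all_boot all_order all_algebra.
From mathcomp Require Import boolp classical_sets.
From mathcomp Require Import separable.
From mathcomp Require Import ring_quotient qpoly fraction generic_quotient mpoly.

Set Implicit Arguments.
Unset Strict Implicit.
Unset Printing Implicit Defensive.

Import Order.TTheory GRing.Theory.
Local Open Scope classical_set_scope.
Local Open Scope ring_scope.
Local Open Scope quotient_scope.

(* A commutative ring presented as finite formal sums of elements of a        *)
(* commutative monoid M with a formal opposite, modulo a congruence of sums.  *)
(* Direct sums of graded pieces and tensor products are both of this shape.   *)

Record sumCong (M : choiceType) := SumCong {
  sc_one : M;
  sc_mul : M -> M -> M;
  sc_opp : M -> M;
  sc_eq : seq M -> seq M -> Prop;
  sc_mulA : associative sc_mul;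
  sc_mulC : commutative sc_mul;
  sc_mul1 : left_id sc_one sc_mul;
  sc_sym : forall s t, sc_eq s t -> sc_eq t s;
  sc_trans : forall s t r, sc_eq s t -> sc_eq t r -> sc_eq s r;
  sc_perm : forall s t, perm_eq s t -> sc_eq s t;
  sc_cat : forall s t r, sc_eq s t -> sc_eq (s ++ r) (t ++ r);
  sc_mulr : forall s t y, sc_eq s t ->
    sc_eq [seq sc_mul x y | x <- s] [seq sc_mul x y | x <- t];
  sc_addN : forall x, sc_eq [:: x; sc_opp x] [::]
}.

Section SumRing.
Variables (M : choiceType) (C : sumCong M).
Implicit Types s t r : seq M.
Local Notation E := (sc_eq C).

Definition sum_eqv s t := `[< E s t >].
Definition sum_prod s t := [seq sc_mul C x y | x <- s, y <- t].
Definition sum_opp s := map (sc_opp C) s.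

Lemma sc_refl s : E s s. Proof. exact: sc_perm. Qed.

Lemma sc_catl s t r : E s t -> E (r ++ s) (r ++ t).
Proof.
move=> st; apply: (sc_trans (t := s ++ r)); first by apply: sc_perm; rewrite perm_catC.
apply: (sc_trans (t := t ++ r)); first exact: sc_cat.
by apply: sc_perm; rewrite perm_catC.
Qed.

Lemma sc_cat2 s s' t t' : E s s' -> E t t' -> E (s ++ t) (s' ++ t').
Proof. by move=> ss' tt'; apply: sc_trans (sc_cat _ ss') (sc_catl _ tt'). Qed.

Lemma sum_eqv_equiv : equiv_class_of sum_eqv.
Proof.
split=> [s|s t|t s r]; first by apply/asboolP; apply: sc_refl.
  by apply/asboolP/asboolP; apply: sc_sym.
by move=> /asboolP st /asboolP tr; apply/asboolP; apply: sc_trans st tr.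
Qed.

Canonical sum_eqv_equivRel := EquivRelPack sum_eqv_equiv.
Canonical sum_eqv_encModRel := defaultEncModRel sum_eqv.

Definition sumRing := {eq_quot sum_eqv}.
HB.instance Definition _ := EqQuotient.on sumRing.
HB.instance Definition _ := Choice.on sumRing.

Lemma sumRingP s t : \pi_sumRing s = \pi_sumRing t <-> E s t.
Proof.
split=> [/eqP|st]; first by rewrite eqmodE => /asboolP.
by apply/eqP; rewrite eqmodE; apply/asboolP.
Qed.

Lemma sc_addN_seq s : E (s ++ sum_opp s) [::].
Proof.
elim: s => [|x s IH] /=; first exact: sc_refl.
apply: (sc_trans (t := [:: x; sc_opp C x] ++ (s ++ sum_opp s))).
  apply: sc_perm; rewrite /= perm_cons -/(sum_opp s).
  by rewrite -cat1s perm_catCA.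
exact: sc_cat2 (sc_addN C x) IH.
Qed.

Lemma sum_opp_congr s t : E s t -> E (sum_opp s) (sum_opp t).
Proof.
move=> st; apply: (sc_trans (t := sum_opp s ++ (t ++ sum_opp t))).
  by rewrite -{1}[sum_opp s]cats0; apply/sc_catl/sc_sym/sc_addN_seq.
apply: (sc_trans (t := (s ++ sum_opp s) ++ sum_opp t)).
  rewrite catA; apply: sc_cat.
  apply: (sc_trans (t := sum_opp s ++ s)); first exact/sc_catl/sc_sym.
  by apply: sc_perm; rewrite perm_catC.
by apply: (sc_trans (sc_cat _ (sc_addN_seq s))); apply: sc_refl.
Qed.

Lemma sum_prodC s t : E (sum_prod s t) (sum_prod t s).
Proof.
apply: sc_perm; rewrite /sum_prod.
rewrite (_ : [seq sc_mul C x y | x <- t, y <- s]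
           = [seq sc_mul C y x | x <- t, y <- s]); last first.
  by apply: eq_allpairs => x y; rewrite sc_mulC.
elim: s => [|x s IH] /=; first by elim: t => //= ? t <-.
rewrite perm_sym (perm_allpairs_consr (fun x y => sc_mul C y x) t (fun=> x) (fun=> s)).
by rewrite perm_cat2l perm_sym.
Qed.

Lemma sum_prodl s s' t : E s s' -> E (sum_prod s t) (sum_prod s' t).
Proof.
move=> ss'; elim: t => [|y t IH].
  by rewrite /sum_prod !allpairs0r; apply: sc_refl.
have cons u : E (sum_prod u (y :: t)) ([seq sc_mul C x y | x <- u] ++ sum_prod u t).
  by apply: sc_perm; rewrite /sum_prod
    (perm_allpairs_consr (sc_mul C) u (fun=> y) (fun=> t)).
apply: sc_trans (cons s) _; apply: sc_trans (sc_sym (cons s')).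
by apply: sc_cat2 => //; apply: sc_mulr.
Qed.

Lemma sum_prodr s t t' : E t t' -> E (sum_prod s t) (sum_prod s t').
Proof.
move=> tt'; apply: (sc_trans (sum_prodC _ _)).
exact: sc_trans (sum_prodl _ tt') (sum_prodC _ _).
Qed.

Lemma sum_prodA s t r : sum_prod s (sum_prod t r) = sum_prod (sum_prod s t) r.
Proof.
elim: s => [|x s IH] //=.
rewrite /sum_prod allpairs_cat -/(sum_prod _ r) /=.
rewrite -[in RHS]/(sum_prod (sum_prod s t) r) -IH; congr (_ ++ _).
elim: t {IH} => [|y t IH] //=; rewrite map_cat IH -map_comp.
by congr (_ ++ _); apply: eq_map => z /=; rewrite sc_mulA.
Qed.

Definition sr_zero : sumRing := \pi_sumRing [::].
Definition sr_one : sumRing := \pi_sumRing [:: sc_one C].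
Definition sr_add (a b : sumRing) : sumRing :=
  locked (\pi_sumRing (repr a ++ repr b)).
Definition sr_opp (a : sumRing) : sumRing :=
  locked (\pi_sumRing (sum_opp (repr a))).
Definition sr_mul (a b : sumRing) : sumRing :=
  locked (\pi_sumRing (sum_prod (repr a) (repr b))).

Lemma repr_sc s : E (repr (\pi_sumRing s)) s.
Proof. by apply/sumRingP; rewrite reprK. Qed.

Lemma pi_sr_add s t : sr_add (\pi_sumRing s) (\pi_sumRing t) = \pi_sumRing (s ++ t).
Proof. by rewrite /sr_add -lock; apply/sumRingP/sc_cat2; apply: repr_sc. Qed.

Lemma pi_sr_opp s : sr_opp (\pi_sumRing s) = \pi_sumRing (sum_opp s).
Proof. by rewrite /sr_opp -lock; apply/sumRingP/sum_opp_congr/repr_sc. Qed.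

Lemma pi_sr_mul s t : sr_mul (\pi_sumRing s) (\pi_sumRing t) = \pi_sumRing (sum_prod s t).
Proof.
rewrite /sr_mul -lock; apply/sumRingP; apply: (sc_trans (sum_prodl _ (repr_sc s))).
exact/sum_prodr/repr_sc.
Qed.

Lemma sr_addA : associative sr_add.
Proof. by elim/quotW=> s; elim/quotW=> t; elim/quotW=> r; rewrite !pi_sr_add catA. Qed.
Lemma sr_addC : commutative sr_add.
Proof.
by elim/quotW=> s; elim/quotW=> t; rewrite !pi_sr_add; apply/sumRingP/sc_perm; rewrite perm_catC.
Qed.
Lemma sr_add0 : left_id sr_zero sr_add.
Proof. by elim/quotW=> s; rewrite pi_sr_add. Qed.
Lemma sr_addN : left_inverse sr_zero sr_opp sr_add.
Proof.
by elim/quotW=> s; rewrite sr_addC pi_sr_opp pi_sr_add; apply/sumRingP/sc_addN_seq.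
Qed.
HB.instance Definition _ :=
  GRing.isZmodule.Build sumRing sr_addA sr_addC sr_add0 sr_addN.

Lemma sr_mulA : associative sr_mul.
Proof. by elim/quotW=> s; elim/quotW=> t; elim/quotW=> r; rewrite !pi_sr_mul sum_prodA. Qed.
Lemma sr_mulC : commutative sr_mul.
Proof. by elim/quotW=> s; elim/quotW=> t; rewrite !pi_sr_mul; apply/sumRingP/sum_prodC. Qed.
Lemma sr_mul1 : left_id sr_one sr_mul.
Proof.
elim/quotW=> s; rewrite pi_sr_mul /sum_prod /= cats0.
by rewrite (eq_map (sc_mul1 C)) map_id.
Qed.
Lemma sr_mulD : left_distributive sr_mul sr_add.
Proof.
elim/quotW=> s; elim/quotW=> t; elim/quotW=> r.
by rewrite !(pi_sr_mul, pi_sr_add) /sum_prod allpairs_cat.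
Qed.
HB.instance Definition _ :=
  GRing.Zmodule_isComPzRing.Build sumRing sr_mulA sr_mulC sr_mul1 sr_mulD.

Lemma sumRingD s t : \pi_sumRing s + \pi_sumRing t = \pi_sumRing (s ++ t).
Proof. exact: pi_sr_add. Qed.
Lemma sumRingN s : - \pi_sumRing s = \pi_sumRing (sum_opp s).
Proof. exact: pi_sr_opp. Qed.
Lemma sumRingM s t : \pi_sumRing s * \pi_sumRing t = \pi_sumRing (sum_prod s t).
Proof. exact: pi_sr_mul. Qed.
Lemma sumRing0 : \pi_sumRing [::] = 0. Proof. by []. Qed.
Lemma sumRing1 : \pi_sumRing [:: sc_one C] = 1. Proof. by []. Qed.

End SumRing.

Section Retraction.
Variables (k : fieldType) (A : comNzRingType) (f : {rmorphism k -> A}).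

Let good (W : set A) : Prop :=
  [/\ forall c x y, W x -> W y -> W (f c * x + y), W 0 & ~ W 1].

Let good_max : exists W, good W /\ forall W', (W `<` W') -> ~ good W'.
Proof.
pose P := [set W : set A | W = set0 \/ good W].
have [W [PW maxW]] : exists W, P W /\ forall W', (W `<` W') -> ~ P W'.
  apply: Zorn_bigcup => F FP Ftot.
  have [[X0 FX0 gX0]|noF] := pselect (exists2 X, F X & good X); last first.
    left; apply/seteqP; split=> // x [X FX Xx].
    by case: (FP _ FX) => [Xe|gX]; [rewrite Xe in Xx | case: noF; exists X].
  right; split; last 1 first.
  - case=> X FX X1; case: (FP _ FX) => [Xe|[_ _]] //.
    by rewrite Xe in X1.
  - move=> c x y [X FX Xx] [Y FY Yy].
    have [Z [FZ Zx Zy]] : exists Z, [/\ F Z, Z x & Z y].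
      by case: (Ftot _ _ FX FY) => s; [exists Y|exists X]; split=> //; apply: s.
    exists Z => //; case: (FP _ FZ) => [Z0|[cl _ _]]; last exact: cl.
    by rewrite Z0 in Zx.
  - by exists X0 => //; case: gX0.
have gW : good W.
  case: PW => // W0; exfalso; apply: (maxW [set 0 : A]).
    by rewrite W0; split=> // /(_ 0 erefl).
  right; split=> //; first by move=> c x y /= -> ->; rewrite mulr0 addr0.
  by move=> /= /eqP; rewrite oner_eq0.
by exists W; split=> // W' /maxW nW' gW'; apply: nW'; right.
Qed.

Lemma linear_retraction : exists phi : A -> k,
  [/\ phi 1 = 1, phi 0 = 0, forall x y, phi (x + y) = phi x + phi y
    & forall c x, phi (f c * x) = c * phi x].
Proof.
have [W [[cl W0 W1] maxW]] := good_max.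
have clD x y : W x -> W y -> W (x + y) by move=> Wx Wy; rewrite -[x]mul1r -(rmorph1 f); apply: cl.
have clM c x : W x -> W (f c * x) by move=> Wx; rewrite -[_ * _]addr0; apply: cl.
have clB x y : W x -> W y -> W (x - y).
  by move=> Wx Wy; rewrite addrC -mulN1r -(rmorph1 f) -rmorphN; apply: cl.
have dec x : exists c, W (x - f c).
  have [Wx|nWx] := pselect (W x); first by exists 0; rewrite rmorph0 subr0.
  pose W' := [set z | exists w c, W w /\ z = w + f c * x].
  have : W' 1.
    apply: contrapT => nW'1; apply: (maxW W').
      split=> [w Ww|/(_ x)]; first by exists w, 0; rewrite rmorph0 mul0r addr0.
      by move=> s; apply: nWx; apply: s; exists 0, 1; rewrite rmorph1 mul1r add0r.
    split=> //; last by exists 0, 0; rewrite rmorph0 mul0r addr0.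
    move=> c _ _ [w [d [Ww ->]]] [w' [d' [Ww' ->]]].
    exists (f c * w + w'), (c * d + d'); split; first exact: cl.
    by rewrite rmorphD rmorphM mulrDr mulrDl -!addrA mulrA; congr (_ + _); rewrite addrCA.
  case=> w [c [Ww e]]; have c0 : c != 0.
    by apply: contra_notN W1 => /eqP c0; rewrite e c0 rmorph0 mul0r addr0.
  exists c^-1.
  have -> : x - f c^-1 = f (- c^-1) * w.
    rewrite rmorphN mulNr -[f c^-1 in LHS]mulr1 e mulrDr mulrA -rmorphM mulVf // rmorph1 mul1r.
    by rewrite opprD addrCA subrr addr0.
  exact: clM.
have uni x c d : W (x - f c) -> W (x - f d) -> c = d.
  move=> Wc Wd; apply/eqP; rewrite -subr_eq0; apply/negPn/negP => cd0; apply: W1.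
  rewrite -(rmorph1 f) -(mulVf cd0) rmorphM; apply: clM; rewrite rmorphB.
  by rewrite (_ : f c - f d = (x - f d) - (x - f c)); [apply: clB|rewrite opprB [RHS]addrC addrA subrK].
pose phi x := projT1 (cid (dec x)).
have phiP x : W (x - f (phi x)) by rewrite /phi; case: cid.
exists phi; split.
- by apply: (uni 1) => //; rewrite rmorph1 subrr.
- by apply: (uni 0) => //; rewrite rmorph0 subrr.
- move=> x y; apply: (uni (x + y)) => //.
  by rewrite rmorphD opprD addrACA; apply: clD.
- move=> c x; apply: (uni (f c * x)) => //.
  by rewrite rmorphM -mulrBr; apply: clM.
Qed.
End Retraction.

Section Tensor.
Variables (k : fieldType) (A B : comNzRingType).
Variables (f : {rmorphism k -> A}) (g : {rmorphism k -> B}).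
Implicit Types s t r : seq (A * B).

(* The tensor product A (x)_k B: (a, b) stands for a (x) b, k acts on A via f *)
(* and on B via g, and a list is the sum of its pure tensors.                 *)
Inductive tens_eq : seq (A * B) -> seq (A * B) -> Prop :=
| TensSym s t of tens_eq s t : tens_eq t s
| TensTrans s t r of tens_eq s t & tens_eq t r : tens_eq s r
| TensPerm s t of perm_eq s t : tens_eq s t
| TensCat s t r of tens_eq s t : tens_eq (s ++ r) (t ++ r)
| Tens0 b : tens_eq [:: (0, b)] [::]
| TensDl a a' b : tens_eq [:: (a + a', b)] [:: (a, b); (a', b)]
| TensDr a b b' : tens_eq [:: (a, b + b')] [:: (a, b); (a, b')]
| TensZ c a b : tens_eq [:: (f c * a, b)] [:: (a, g c * b)].

Let tmul (x y : A * B) := (x.1 * y.1, x.2 * y.2).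

Lemma tens_mulA : associative tmul.
Proof. by move=> [a b] [c d] [a' b']; rewrite /tmul /= !mulrA. Qed.
Lemma tens_mulC : commutative tmul.
Proof. by move=> [a b] [c d]; rewrite /tmul /= mulrC [b * d]mulrC. Qed.
Lemma tens_mul1 : left_id (1, 1) tmul.
Proof. by move=> [a b]; rewrite /tmul /= !mul1r. Qed.
Lemma tens_mulr s t y : tens_eq s t ->
  tens_eq [seq tmul x y | x <- s] [seq tmul x y | x <- t].
Proof.
case: y => c d; elim=> {s t} [s t _|s t r _ IH1 _|s t st|s t r _ IH|b|a a' b|a b b'|e a b].
- exact: TensSym.
- exact: TensTrans IH1.
- exact/TensPerm/perm_map.
- by rewrite !map_cat; apply: TensCat.
- by rewrite /tmul /= mul0r; apply: Tens0.
- by rewrite /tmul /= mulrDl; apply: TensDl.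
- by rewrite /tmul /= mulrDl; apply: TensDr.
- by rewrite /tmul /= -!mulrA; apply: TensZ.
Qed.
Lemma tens_addN (x : A * B) : tens_eq [:: x; (- x.1, x.2)] [::].
Proof.
case: x => a b /=; apply: TensTrans (TensSym (TensDl a (- a) b)) _.
by rewrite subrr; apply: Tens0.
Qed.

Definition tens_cong : sumCong (A * B)%type :=
  SumCong tens_mulA tens_mulC tens_mul1
    TensSym TensTrans TensPerm TensCat tens_mulr tens_addN.

Definition tensor := sumRing tens_cong.
HB.instance Definition _ := GRing.ComPzRing.on tensor.

Definition tens (a : A) (b : B) : tensor := \pi_(sumRing tens_cong) [:: (a, b)].

Lemma tensor_nontrivial : (1 : tensor) != 0.
Proof.
have [phi [phi1 phi0 phiD phiZ]] := linear_retraction f.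
pose F s : B := \sum_(x <- s) g (phi x.1) * x.2.
have FE s t : tens_eq s t -> F s = F t.
  elim=> {s t} [s t _|s t r _ ->|s t st|s t r _ IH|b|a a' b|a b b'|c a b] //.
  - exact: perm_big.
  - by rewrite /F !big_cat /= -/(F s) IH.
  - by rewrite /F !big_cons !big_nil addr0 /= phi0 rmorph0 mul0r.
  - by rewrite /F !big_cons !big_nil !addr0 /= phiD rmorphD mulrDl.
  - by rewrite /F !big_cons !big_nil !addr0 /= mulrDr.
  - by rewrite /F !big_cons !big_nil !addr0 /= phiZ rmorphM -mulrA mulrCA.
apply/negP => /eqP e.
have /(sumRingP tens_cong) /FE : \pi_(sumRing tens_cong) [:: (1, 1)] = \pi_(sumRing tens_cong) [::] by [].
rewrite /F !big_cons !big_nil addr0 /= phi1 rmorph1 mulr1 => /eqP.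
by rewrite oner_eq0.
Qed.
HB.instance Definition _ := GRing.PzSemiRing_isNonZero.Build tensor tensor_nontrivial.

End Tensor.

Section RingNotions.
Variable A : comNzRingType.

Definition nonunits : {pred A} := fun a => ~~ `[< exists b, b * a = 1 >].

Definition local_ring : Prop :=
  forall a b, a \in nonunits -> b \in nonunits -> a + b \in nonunits.

Definition is_ideal (I : set A) : Prop :=
  [/\ I 0, forall a b, I a -> I b -> I (a + b) & forall a b, I b -> I (a * b)].

Definition ideal_gen n (x : 'I_n -> A) : set A :=
  [set a | exists c : 'I_n -> A, a = \sum_i c i * x i].

Definition noetherian : Prop :=
  forall I, is_ideal I -> exists n (x : 'I_n -> A), I = ideal_gen x.

Definition prime_chain n (P : nat -> prime_idealr A) : Prop :=
  forall i, (i < n)%N ->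
    {subset P i <= P i.+1} /\ ~ {subset P i.+1 <= P i}.

Definition has_krull_dim (d : nat) : Prop :=
  (exists P, prime_chain d P) /\ ~ (exists P, prime_chain d.+1 P).

Definition regular_local_ring (d : nat) : Prop :=
  [/\ noetherian, local_ring, has_krull_dim d
    & exists x : 'I_d -> A, [set a | a \in nonunits] = ideal_gen x].

End RingNotions.

Arguments nonunits : clear implicits.

Lemma nonunitsP (A : comNzRingType) (a : A) :
  reflect (~ exists b, b * a = 1) (a \in nonunits A).
Proof. by rewrite -topredE /= /nonunits; apply: (iffP negP) => h /asboolP. Qed.

Section FieldNotions.
Variable E : fieldType.

Definition field_gen (X : set E) : {pred E} :=
  fun z => `[< forall F : divringClosed E, (forall x, X x -> x \in F) -> z \in F >].

Definition ring_gen (X : set E) : {pred E} :=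
  fun z => `[< forall A : subringClosed E, (forall x, X x -> x \in A) -> z \in A >].

Lemma ring_gen_subring (X : set E) : subring_closed (ring_gen X).
Proof.
split=> [|a b|a b]; first by apply/asboolP => A _; apply: rpred1.
  by move=> /asboolP ha /asboolP hb; apply/asboolP => A XA; rewrite rpredB ?ha ?hb.
by move=> /asboolP ha /asboolP hb; apply/asboolP => A XA; rewrite rpredM ?ha ?hb.
Qed.
HB.instance Definition _ (X : set E) :=
  GRing.isSubringClosed.Build E (ring_gen X) (ring_gen_subring X).

Definition algebraic_over (F : {pred E}) (z : E) : Prop :=
  exists p : {poly E}, [/\ p \is a polyOver F, p != 0 & root p z].

Definition separable_over (F : {pred E}) (z : E) : Prop :=
  exists p : {poly E}, [/\ p \is a polyOver F, separable_poly p & root p z].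

Definition algebraically_independent (F : {pred E}) n (x : 'I_n -> E) : Prop :=
  forall p : {mpoly E[n]}, p \is a mpolyOver n F -> p.@[x] = 0 -> p = 0.

Definition has_trdeg (F : {pred E}) (n : nat) : Prop :=
  exists x : 'I_n -> E, algebraically_independent F x /\
    forall z, algebraic_over (field_gen [set y | y \in F \/ exists i, y = x i]) z.

(* E has a basis of n elements over its subfield F. *)
Definition has_degree (F : {pred E}) (n : nat) : Prop :=
  exists b : 'I_n -> E, forall z, exists! c : {ffun 'I_n -> E},
    (forall i, c i \in F) /\ z = \sum_i c i * b i.

Definition linearly_independent (F : {pred E}) n (x : 'I_n -> E) : Prop :=
  forall c : 'I_n -> E, (forall i, c i \in F) ->
    \sum_i c i * x i = 0 -> forall i, c i = 0.

Definition linearly_disjoint (A B C : {pred E}) : Prop :=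
  forall n (x : 'I_n -> E), (forall i, x i \in A) ->
    linearly_independent C x -> linearly_independent B x.

Definition is_join (A B : {pred E}) : Prop :=
  forall z, z \in field_gen [set y | y \in A \/ y \in B].

Definition whole : {pred E} := fun=> true.
Lemma whole_divring : divring_closed whole. Proof. by []. Qed.
HB.instance Definition _ := GRing.isDivringClosed.Build E whole whole_divring.

End FieldNotions.
Arguments whole : clear implicits.

Section Fractions.
Variables (A B : idomainType) (h : A -> B).

(* for h injective, the image of Frac(A) in Frac(B) *)
Definition frac_image : {pred {fraction B}} := fun z =>
  `[< exists a b : A, b != 0 /\
        z = FracField.tofrac (h a) / FracField.tofrac (h b) >].
End Fractions.

Section Subrings.
Variable L : fieldType.

Definition subr (R : subringClosed L) := {x : L | x \in R}.
HB.instance Definition _ (R : subringClosed L) := SubChoice.on (subr R).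
HB.instance Definition _ (R : subringClosed L) :=
  [SubChoice_isSubComNzRing of subr R by <:].

Definition mk_subr (R : subringClosed L) x (Rx : x \in R) : subr R :=
  exist (fun x => x \in R) x Rx.

Record localSubring := LocalSubring {
  lsub :> subringClosed L;
  lsub_local : local_ring (subr lsub)
}.

Implicit Types R S : localSubring.

Definition maxi R : {pred subr R} := nonunits (subr R).
Arguments maxi : clear implicits.

Lemma maxi_ideal R : idealr_closed (maxi R).
Proof.
have M a b : b \in maxi R -> a * b \in maxi R.
  move=> /nonunitsP nb; apply/nonunitsP => -[c e]; apply: nb.
  by exists (c * a); rewrite -mulrA.
split=> [| |a b c Rb Rc].
- by apply/nonunitsP => -[b]; rewrite mulr0 => /esym/eqP; rewrite oner_eq0.
- by apply/nonunitsP; apply; exists 1; rewrite mulr1.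
- by apply: lsub_local => //; apply: M.
Qed.
HB.instance Definition _ R := isIdealr.Build (subr R) (maxi R) (maxi_ideal R).

Definition max_ideal R : {pred L} :=
  fun x => `[< exists2 a : subr R, a \in maxi R & val a = x >].

Lemma mxP R x : reflect (x \in R /\ ~ (x != 0 /\ x^-1 \in R)) (x \in max_ideal R).
Proof.
apply: (iffP (asboolP _)) => [[a /nonunitsP na <-]|[Rx nx]].
  split=> [|[a0 Ra]]; first exact: valP.
  by apply: na; exists (mk_subr Ra); apply: val_inj; rewrite /= mulVf.
exists (mk_subr Rx) => //; apply/nonunitsP => -[b /(congr1 val) /= bx].
have x0 : x != 0 by apply: contra_eq_neq bx => ->; rewrite mulr0 eq_sym oner_eq0.
apply: nx; split=> //; suff -> : x^-1 = val b by apply: valP.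
by rewrite -[LHS]mul1r -bx mulfK.
Qed.

Definition dominates S R : Prop :=
  {subset R <= S} /\ forall x, (x \in max_ideal S) && (x \in R) = (x \in max_ideal R).

Definition res R := {ideal_quot (maxi R)}.
HB.instance Definition _ R := GRing.ComNzRing.on (res R).

Definition res_cls R (x : L) : res R := \pi_{ideal_quot (maxi R)} (insubd 0 x).

Lemma res_clsE R (a : subr R) : res_cls R (val a) = \pi_{ideal_quot (maxi R)} a.
Proof. by rewrite /res_cls valKd. Qed.

Lemma res_cls_eq R x y : x \in R -> y \in R ->
  (res_cls R x == res_cls R y) = (x - y \in max_ideal R).
Proof.
move=> Rx Ry; rewrite -[x]/(val (mk_subr Rx)) -[y]/(val (mk_subr Ry)).
rewrite !res_clsE -Quotient.idealrBE -rmorphB.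
apply/idP/asboolP => [h|[a ha]]; first by exists ((mk_subr Rx) - (mk_subr Ry)).
by move/val_inj <-.
Qed.

Lemma res_clsB R x y : x \in R -> y \in R ->
  res_cls R (x - y) = res_cls R x - res_cls R y.
Proof.
move=> Rx Ry; rewrite -[x]/(val (mk_subr Rx)) -[y]/(val (mk_subr Ry)).
by rewrite -rmorphB !res_clsE !piE.
Qed.

Lemma res_clsM R x y : x \in R -> y \in R ->
  res_cls R (x * y) = res_cls R x * res_cls R y.
Proof.
move=> Rx Ry; rewrite -[x]/(val (mk_subr Rx)) -[y]/(val (mk_subr Ry)).
by rewrite -rmorphM !res_clsE !piE.
Qed.

Lemma res_cls1 R : res_cls R 1 = 1.
Proof. by rewrite -[1]/(val (1 : subr R)) res_clsE rmorph1. Qed.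

Lemma res_cls0 R : res_cls R 0 = 0.
Proof. by rewrite -(subrr 1) res_clsB ?rpred1 // subrr. Qed.

Definition res_rep R (c : res R) : L := val (repr c : subr R).

Lemma res_repP R (c : res R) : res_rep c \in R. Proof. exact: valP. Qed.

Lemma res_repK R (c : res R) : res_cls R (res_rep c) = c.
Proof. by rewrite res_clsE reprK. Qed.

Definition res_inv R (c : res R) : res R :=
  if c == 0 then 0 else res_cls R (res_rep c)^-1.

Lemma res_mulVf R (c : res R) : c != 0 -> res_inv c * c = 1.
Proof.
move=> c0; rewrite /res_inv (negPf c0) -[c in _ * c]res_repK.
have : res_rep c \notin max_ideal R.
  apply: contra c0; rewrite -{2}[c]res_repK -(res_cls0 R).
  by rewrite res_cls_eq ?rpred0 ?subr0 ?res_repP.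
move=> /mxP h; have [x0 Rx] : res_rep c != 0 /\ (res_rep c)^-1 \in R.
  by apply: contrapT => h'; apply: h; split=> //; apply: res_repP.
by rewrite -res_clsM ?res_repP // mulVf // res_cls1.
Qed.

Lemma res_inv0 R : res_inv (0 : res R) = 0.
Proof. by rewrite /res_inv eqxx. Qed.

HB.instance Definition _ R := GRing.ComNzRing_isField.Build (res R) (@res_mulVf R) (res_inv0 R).

Definition res_map S R (_ : dominates S R) (c : res R) : res S :=
  res_cls S (res_rep c).

Lemma res_mapE S R (d : dominates S R) x : x \in R ->
  res_map d (res_cls R x) = res_cls S x.
Proof.
move=> Rx; apply/eqP; rewrite res_cls_eq ?(d.1 _ (res_repP _)) ?(d.1 _ Rx) //.
have : res_rep (res_cls R x) - x \in max_ideal R by rewrite -res_cls_eq ?res_repP ?res_repK.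
by rewrite -d.2 => /andP[].
Qed.

Lemma res_map_zmod S R (d : dominates S R) : zmod_morphism (res_map d).
Proof.
move=> a b; rewrite -[a]res_repK -[b]res_repK -res_clsB ?res_repP //.
by rewrite !res_mapE ?rpredB ?res_repP // res_clsB ?(d.1 _ (res_repP _)).
Qed.

Lemma res_map_monoid S R (d : dominates S R) : monoid_morphism (res_map d).
Proof.
split; first by rewrite -(res_cls1 R) res_mapE ?rpred1 // res_cls1.
move=> a b; rewrite -[a]res_repK -[b]res_repK -res_clsM ?res_repP //.
by rewrite !res_mapE ?rpredM ?res_repP // res_clsM ?(d.1 _ (res_repP _)).
Qed.

HB.instance Definition _ S R (d : dominates S R) :=
  GRing.isZmodMorphism.Build (res R) (res S) (res_map d) (res_map_zmod d).
HB.instance Definition _ S R (d : dominates S R) :=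
  GRing.isMonoidMorphism.Build (res R) (res S) (res_map d) (res_map_monoid d).

(* the image in W / m_W of a subset A of W; when W dominates R this is R/m_R  *)
(* viewed as a subfield of W / m_W                                            *)
Definition res_image W (A : {pred L}) : {pred res W} :=
  fun c => `[< exists2 x, x \in A & c = res_cls W x >].

Lemma dominates_trans W S R : dominates W S -> dominates S R -> dominates W R.
Proof.
move=> [sSW mS] [sRS mR]; split=> [x /sRS/sSW //|x]; rewrite -mR -mS.
by apply/andP/andP => [[-> Rx]|[/andP[-> _] ->]]; rewrite ?(sRS _ Rx).
Qed.

End Subrings.
Arguments res_image {L} W A.
Arguments maxi {L} R.
Arguments max_ideal {L} R.

HB.mixin Record isOrderedGroup G of Num.POrderedZmodule G := {
  oag_total : forall a b : G, (a <= b) || (b <= a);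
  oag_leD2r : forall a b c : G, a <= b -> a + c <= b + c
}.

#[short(type="oagType")]
HB.structure Definition OrderedGroup :=
  {G of isOrderedGroup G & Num.POrderedZmodule G}.

Section OagTheory.
Variable G : oagType.
Implicit Types a b c : G.

Lemma oag_leD a b c d : a <= b -> c <= d -> a + c <= b + d.
Proof.
move=> ab cd; apply: le_trans (oag_leD2r _ _ c ab) _.
by rewrite ![b + _]addrC; apply: oag_leD2r.
Qed.

Lemma oag_leD2rE a b c : (a + c <= b + c) = (a <= b).
Proof.
apply/idP/idP => [|/oag_leD2r //].
by move=> /(oag_leD2r _ _ (- c)); rewrite !addrK.
Qed.

Lemma oag_ltD2rE a b c : (a + c < b + c) = (a < b).
Proof. by rewrite !lt_neqAle oag_leD2rE (inj_eq (addIr c)). Qed.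

Lemma oag_ltNge a b : (a < b) = ~~ (b <= a).
Proof.
rewrite lt_neqAle; apply/andP/idP => [[ab le_ab]|nba].
  by apply: contra ab => ba; rewrite eq_le le_ab.
have ab : a <= b by have := oag_total a b; rewrite (negPf nba) orbF.
by split=> //; apply: contraNneq nba => ->.
Qed.

Lemma oag_leD_lt a b c d : a <= b -> c < d -> a + c < b + d.
Proof.
move=> ab cd; apply: (@le_lt_trans _ _ (b + c)); first exact: oag_leD2r.
by rewrite ![b + _]addrC oag_ltD2rE.
Qed.
End OagTheory.

(* A Krull valuation with value group G; the value of 0 is +oo, which is      *)
(* encoded by treating 0 separately: val_fun 0 is irrelevant.                 *)
Record valuation (L : fieldType) (G : oagType) := Valuation {
  val_fun :> L -> G;
  val_mul : forall x y, x != 0 -> y != 0 -> val_fun (x * y) = val_fun x + val_fun y;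
  val_add : forall x y, x != 0 -> y != 0 -> x + y != 0 ->
    Num.min (val_fun x) (val_fun y) <= val_fun (x + y);
  val_surj : forall g, exists2 x, x != 0 & val_fun x = g
}.

Section Valuation.
Variables (L : fieldType) (G : oagType) (v : valuation L G).
Implicit Types (x y : L) (g : G).

(* nu(x) >= g and nu(x) > g, with nu(0) = +oo *)
Definition val_ge g : {pred L} := fun x => (x == 0) || (g <= v x).
Definition val_gt g : {pred L} := fun x => (x == 0) || (g < v x).

Lemma val1 : v 1 = 0.
Proof.
have := val_mul v (oner_neq0 L) (oner_neq0 L); rewrite mulr1 => e.
by apply: (addrI (v 1)); rewrite -e addr0.
Qed.

Lemma valN x : v (- x) = v x.
Proof.
have [->|x0] := eqVneq x 0; first by rewrite oppr0.
have N1 : (-1 : L) != 0 by rewrite oppr_eq0 oner_eq0.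
have vN1 : v (-1) = 0.
  have := val_mul v N1 N1; rewrite mulrNN mulr1 val1 => e.
  apply/eqP; rewrite eq_le; apply/andP; split.
    have [//|/= h] := boolP (v (-1) <= 0).
    rewrite -oag_ltNge in h.
    by have := oag_leD_lt (ltW h) h; rewrite -e addr0 ltxx.
  have [//|/= h] := boolP (0 <= v (-1)).
  rewrite -oag_ltNge in h.
  by have := oag_leD_lt (ltW h) h; rewrite -e addr0 ltxx.
by rewrite -mulN1r val_mul // vN1 add0r.
Qed.

Lemma valV x : x != 0 -> v x^-1 = - v x.
Proof.
move=> x0; apply: (addrI (v x)).
by rewrite -val_mul ?invr_eq0 // divff // val1 subrr.
Qed.

Lemma val_ge0 g : 0 \in val_ge g. Proof. by rewrite -topredE /= /val_ge eqxx. Qed.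
Lemma val_gt0 g : 0 \in val_gt g. Proof. by rewrite -topredE /= /val_gt eqxx. Qed.

Lemma val_gtW g x : x \in val_gt g -> x \in val_ge g.
Proof. by case/orP => [/eqP->|/ltW h]; rewrite ?val_ge0 // -topredE /= /val_ge h orbT. Qed.

Lemma val_geN g x : (- x \in val_ge g) = (x \in val_ge g).
Proof. by rewrite -!topredE /= /val_ge oppr_eq0 valN. Qed.
Lemma val_gtN g x : (- x \in val_gt g) = (x \in val_gt g).
Proof. by rewrite -!topredE /= /val_gt oppr_eq0 valN. Qed.

Lemma val_geD g x y : x \in val_ge g -> y \in val_ge g -> x + y \in val_ge g.
Proof.
have [->|x0] := eqVneq x 0; first by rewrite add0r.
have [->|y0] := eqVneq y 0; first by rewrite addr0.
rewrite -!topredE /= /val_ge (negPf x0) (negPf y0) /= => gx gy.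
have [//|s0] := eqVneq (x + y) 0.
by apply: le_trans (val_add v x0 y0 s0); rewrite /Order.min; case: ifP.
Qed.

Lemma val_gtD g x y : x \in val_gt g -> y \in val_gt g -> x + y \in val_gt g.
Proof.
have [->|x0] := eqVneq x 0; first by rewrite add0r.
have [->|y0] := eqVneq y 0; first by rewrite addr0.
rewrite -!topredE /= /val_gt (negPf x0) (negPf y0) /= => gx gy.
have [//|s0] := eqVneq (x + y) 0.
by apply: lt_le_trans (val_add v x0 y0 s0); rewrite /Order.min; case: ifP.
Qed.

Lemma val_gtB g x y : x \in val_gt g -> y \in val_gt g -> x - y \in val_gt g.
Proof. by move=> gx gy; apply: val_gtD; rewrite ?val_gtN. Qed.

Lemma val_geM g h x y : x \in val_ge g -> y \in val_ge h -> x * y \in val_ge (g + h).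
Proof.
have [->|x0] := eqVneq x 0; first by rewrite mul0r !val_ge0.
have [->|y0] := eqVneq y 0; first by rewrite mulr0 !val_ge0.
rewrite -!topredE /= /val_ge (negPf x0) (negPf y0) /= mulf_eq0 (negPf x0) (negPf y0) /=.
by rewrite val_mul //; apply: oag_leD.
Qed.

Lemma val_gtM g h x y : x \in val_gt g -> y \in val_ge h -> x * y \in val_gt (g + h).
Proof.
have [->|x0] := eqVneq x 0; first by rewrite mul0r !val_gt0.
have [->|y0] := eqVneq y 0; first by rewrite mulr0 !val_gt0.
rewrite -!topredE /= /val_gt /val_ge (negPf x0) (negPf y0) /= mulf_eq0 (negPf x0) (negPf y0) /=.
by rewrite val_mul // addrC [v x + _]addrC => *; apply: oag_leD_lt.
Qed.

Section OnSubfield.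
Variable F : divringClosed L.

Definition vgroup : {pred G} := fun g =>
  `[< exists2 x, (x \in F) && (x != 0) & v x = g >].

Lemma vgroup_zmod : zmod_closed vgroup.
Proof.
split=> [|a b /asboolP[x /andP[Fx x0] <-] /asboolP[y /andP[Fy y0] <-]]; apply/asboolP.
  by exists 1; rewrite ?rpred1 ?oner_eq0 ?val1.
exists (x / y); last by rewrite val_mul ?invr_eq0 // valV.
by rewrite mulf_neq0 ?invr_eq0 // andbT rpred_div.
Qed.
HB.instance Definition _ := GRing.isZmodClosed.Build G vgroup vgroup_zmod.

Definition vring_pred : {pred L} := fun x => (x \in F) && (x \in val_ge 0).

Lemma vring_subring : subring_closed vring_pred.
Proof.
split=> [|x y /andP[Fx vx] /andP[Fy vy]|x y /andP[Fx vx] /andP[Fy vy]].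
- by apply/andP; rewrite rpred1 -topredE /= /val_ge val1 lexx orbT.
- by apply/andP; rewrite rpredB // val_geD ?val_geN.
- by apply/andP; rewrite rpredM // -[0]addr0 val_geM.
Qed.
HB.instance Definition _ := GRing.isSubringClosed.Build L vring_pred vring_subring.

Lemma vring_nonunits (a : subr vring_pred) :
  (a \in nonunits (subr vring_pred)) = (val a \in val_gt 0).
Proof.
have /andP[Fa va] : val a \in vring_pred := valP a.
apply/nonunitsP/idP => [na|ga [b /(congr1 val) /= e]]; last first.
  have /andP[_ vb] : val b \in vring_pred := valP b.
  have := val_gtM ga vb; rewrite mulrC e addr0 -topredE /= /val_gt val1 ltxx.
  by rewrite oner_eq0.
move: va; rewrite -!topredE /= /val_gt /val_ge.
have [//|a0 /= va] := eqVneq (val a) 0; rewrite lt_neqAle va andbT.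
apply: contra_notN na => /eqP va0.
have Va : (val a)^-1 \in vring_pred.
  by apply/andP; rewrite rpredV // -topredE /= /val_ge valV // -va0 oppr0 lexx orbT.
by exists (mk_subr Va); apply: val_inj; rewrite /= mulVf.
Qed.

Lemma vring_local : local_ring (subr vring_pred).
Proof. by move=> a b; rewrite !vring_nonunits; apply: val_gtD. Qed.

Definition vring : localSubring L := LocalSubring vring_local.

Lemma mx_vring x : (x \in max_ideal vring) = (x \in F) && (x \in val_gt 0).
Proof.
apply/asboolP/andP => [[a]|[Fx vx]].
  rewrite (vring_nonunits a) => va <-; split=> //.
  by have /andP[] : val a \in vring_pred := valP a.
have Vx : x \in vring_pred by apply/andP; split=> //; apply: val_gtW.
by exists (mk_subr Vx : subr vring) => //; rewrite (vring_nonunits (mk_subr Vx)).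
Qed.

End OnSubfield.

(* The associated graded ring of the subring R of L along nu, graded by the   *)
(* value group of the subfield F. A homogeneous term is a pair (g, a) with    *)
(* a in P_g(R), standing for the class of a in P_g(R)/P_g^+(R) in degree g;   *)
(* two formal sums of terms are identified when, for every g, the sums of     *)
(* their terms of degree g agree modulo P_g^+(R).                             *)
Section Graded.
Variables (F : divringClosed L) (R : subringClosed L).

Definition filt_ge g : {pred L} := fun x => (x \in R) && (x \in val_ge g).
Definition filt_gt g : {pred L} := fun x => (x \in R) && (x \in val_gt g).

Definition hterm : Type :=
  {p : G * L | (p.1 \in vgroup F) && (p.2 \in filt_ge p.1)}.
HB.instance Definition _ := SubChoice.on hterm.

Definition hdeg (p : hterm) : G := (val p).1.
Definition hcoef (p : hterm) : L := (val p).2.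

Definition mk_hterm g a (h : (g \in vgroup F) && (a \in filt_ge g)) : hterm :=
  exist (fun p : G * L => (p.1 \in vgroup F) && (p.2 \in filt_ge p.1)) (g, a) h.

Lemma hterm_eq (p q : hterm) : hdeg p = hdeg q -> hcoef p = hcoef q -> p = q.
Proof.
by rewrite /hdeg /hcoef => e1 e2; apply: val_inj; case: (val p) (val q) e1 e2 => ? ? [? ?] /= -> ->.
Qed.

Lemma hdegP p : hdeg p \in vgroup F. Proof. by case/andP: (valP p). Qed.
Lemma hcoefP p : hcoef p \in filt_ge (hdeg p). Proof. by case/andP: (valP p). Qed.

Lemma filt_ge0 g : 0 \in filt_ge g.
Proof. by apply/andP; rewrite rpred0 val_ge0. Qed.
Lemma filt_gt0 g : 0 \in filt_gt g.
Proof. by apply/andP; rewrite rpred0 val_gt0. Qed.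
Lemma filt_geD g a b : a \in filt_ge g -> b \in filt_ge g -> a + b \in filt_ge g.
Proof. by move=> /andP[? ?] /andP[? ?]; apply/andP; rewrite rpredD // val_geD. Qed.
Lemma filt_gtD g a b : a \in filt_gt g -> b \in filt_gt g -> a + b \in filt_gt g.
Proof. by move=> /andP[? ?] /andP[? ?]; apply/andP; rewrite rpredD // val_gtD. Qed.
Lemma filt_gtN g a : (- a \in filt_gt g) = (a \in filt_gt g).
Proof. by apply/andP/andP => -[Ra va]; move: Ra va; rewrite rpredN val_gtN. Qed.
Lemma filt_geM g h a b : a \in filt_ge g -> b \in filt_ge h -> a * b \in filt_ge (g + h).
Proof. by move=> /andP[? ?] /andP[? ?]; apply/andP; rewrite rpredM // val_geM. Qed.
Lemma filt_gtM g h a b : a \in filt_gt g -> b \in filt_ge h -> a * b \in filt_gt (g + h).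
Proof. by move=> /andP[? ?] /andP[? ?]; apply/andP; rewrite rpredM // val_gtM. Qed.

Lemma hone_proof : (0 \in vgroup F) && (1 \in filt_ge 0).
Proof.
rewrite (rpred0 (vgroup F)) /=; apply/andP.
by rewrite rpred1 -topredE /= /val_ge val1 lexx orbT.
Qed.
Definition hone : hterm := mk_hterm hone_proof.

Lemma hmul_proof (p q : hterm) :
  (hdeg p + hdeg q \in vgroup F) && (hcoef p * hcoef q \in filt_ge (hdeg p + hdeg q)).
Proof. by rewrite (rpredD (hdegP p) (hdegP q)) filt_geM ?hcoefP. Qed.
Definition hmul p q : hterm := mk_hterm (hmul_proof p q).

Lemma hopp_proof (p : hterm) :
  (hdeg p \in vgroup F) && (- hcoef p \in filt_ge (hdeg p)).
Proof.
by have /andP[Rp vp] := hcoefP p; rewrite hdegP /=; apply/andP; rewrite rpredN val_geN.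
Qed.
Definition hopp p : hterm := mk_hterm (hopp_proof p).

Definition hcomp (s : seq hterm) g : L := \sum_(p <- s | hdeg p == g) hcoef p.

Definition gr_eq (s t : seq hterm) : Prop :=
  forall g, hcomp s g - hcomp t g \in filt_gt g.

Lemma hcompP s g : hcomp s g \in filt_ge g.
Proof.
rewrite /hcomp; elim/big_ind: _ => [|a b|p /eqP <-]; [exact: filt_ge0|exact: filt_geD|exact: hcoefP].
Qed.

Lemma hcomp_cat s t g : hcomp (s ++ t) g = hcomp s g + hcomp t g.
Proof. by rewrite /hcomp big_cat. Qed.

Lemma hcomp_mulr s q g :
  hcomp [seq hmul p q | p <- s] g = hcomp s (g - hdeg q) * hcoef q.
Proof.
rewrite /hcomp big_map big_distrl /=; apply: eq_bigl => p.
by rewrite -[hdeg (hmul p q)]/(hdeg p + hdeg q) eq_sym -subr_eq eq_sym.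
Qed.

Lemma hmulA : associative hmul.
Proof. by move=> p q r; apply: hterm_eq; [apply: addrA|apply: mulrA]. Qed.
Lemma hmulC : commutative hmul.
Proof. by move=> p q; apply: hterm_eq; [apply: addrC|apply: mulrC]. Qed.
Lemma hmul1 : left_id hone hmul.
Proof. by move=> p; apply: hterm_eq; [apply: add0r|apply: mul1r]. Qed.
Lemma gr_eq_sym s t : gr_eq s t -> gr_eq t s.
Proof. by move=> st g; rewrite -opprB filt_gtN. Qed.
Lemma gr_eq_trans s t r : gr_eq s t -> gr_eq t r -> gr_eq s r.
Proof.
by move=> st tr g; rewrite -[X in X \in _](subrKA (hcomp t g)); apply: filt_gtD.
Qed.
Lemma gr_eq_perm s t : perm_eq s t -> gr_eq s t.
Proof. by move=> st g; rewrite /hcomp (perm_big _ st) subrr filt_gt0. Qed.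
Lemma gr_eq_cat s t r : gr_eq s t -> gr_eq (s ++ r) (t ++ r).
Proof. by move=> st g; rewrite !hcomp_cat opprD addrACA subrr addr0. Qed.
Lemma gr_eq_mulr s t q : gr_eq s t ->
  gr_eq [seq hmul p q | p <- s] [seq hmul p q | p <- t].
Proof.
move=> st g; rewrite !hcomp_mulr -mulrBl -[in filt_gt g](subrK (hdeg q) g).
by apply: filt_gtM => //; apply: hcoefP.
Qed.
Lemma gr_eq_addN p : gr_eq [:: p; hopp p] [::].
Proof.
move=> g; rewrite /hcomp !big_cons !big_nil -[hdeg (hopp p)]/(hdeg p).
rewrite -[hcoef (hopp p)]/(- hcoef p) addr0.
by rewrite subr0; case: (hdeg p == g); rewrite ?subrr filt_gt0.
Qed.

Definition gr_cong : sumCong hterm :=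
  SumCong hmulA hmulC hmul1 gr_eq_sym gr_eq_trans gr_eq_perm
    gr_eq_cat gr_eq_mulr gr_eq_addN.

Definition gr := sumRing gr_cong.
HB.instance Definition _ := GRing.ComPzRing.on gr.

Definition gr_pi (s : seq hterm) : gr := \pi_(sumRing gr_cong) s.

Lemma gr_piP s t : gr_pi s = gr_pi t <-> gr_eq s t.
Proof. exact: sumRingP. Qed.

Lemma gr_piM s t : gr_pi s * gr_pi t = gr_pi [seq hmul p q | p <- s, q <- t].
Proof. exact: sumRingM. Qed.

Lemma gr_nontrivial : (1 : gr) != 0.
Proof.
apply/negP => /eqP e.
have /gr_piP/(_ 0) : gr_pi [:: hone] = gr_pi [::] by [].
rewrite /hcomp big_cons !big_nil eqxx subr0 addr0 => /andP[_].
by rewrite -topredE /= /val_gt /hcoef /= oner_eq0 val1 ltxx.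
Qed.
HB.instance Definition _ := GRing.PzSemiRing_isNonZero.Build gr gr_nontrivial.

Lemma gr_order s : ~ gr_eq s [::] -> exists t a,
  [/\ gr_eq s t, hcomp t a \notin filt_gt a & forall p, p \in t -> a <= hdeg p].
Proof.
elim: {s}(size s) {-2}s (leqnn (size s)) => [|n IH] s sz nz.
  by case: nz; case: s sz => // _ g; rewrite subrr filt_gt0.
have [m ms mmin] : exists2 m, m \in s & forall p, p \in s -> hdeg m <= hdeg p.
  have : s != [::] by apply: contra_notN nz => /eqP ->; move=> g; rewrite subrr filt_gt0.
  elim: s {sz nz IH} => // p [|q s] IHs _.
    by exists p; rewrite ?mem_head // => r; rewrite inE => /eqP ->.
  have [m ms mm] := IHs isT; case/orP: (oag_total (hdeg p) (hdeg m)) => pm.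
    exists p; rewrite ?mem_head // => r; rewrite in_cons => /orP[/eqP->//|/mm].
    exact: le_trans.
  exists m; first by rewrite in_cons ms orbT.
  by move=> r; rewrite in_cons => /orP[/eqP->//|/mm].
have [cm|ncm] := boolP (hcomp s (hdeg m) \in filt_gt (hdeg m)); last first.
  by exists s, (hdeg m); split=> // g; rewrite subrr filt_gt0.
pose t := [seq p <- s | hdeg p != hdeg m].
have st : gr_eq s t.
  move=> g; rewrite /hcomp [X in _ - X]big_filter_cond.
  have [->|gm] := eqVneq g (hdeg m).
    by rewrite [X in _ - X]big1 ?subr0 // => p /andP[/negPf ->].
  rewrite [X in _ - X](eq_bigl (fun p => hdeg p == g)) ?subrr ?filt_gt0 // => p.
  by have [->|] := eqVneq (hdeg p) g; rewrite ?andbF ?gm.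
have [||t' [a [tt' ta tm]]] := IH t.
- rewrite -ltnS; apply: leq_trans sz; rewrite size_filter.
  by rewrite -(count_predC (fun p => hdeg p == hdeg m) s) -addn1 addnC leq_add2r -has_count;
     apply/hasP; exists m.
- by move=> t0; apply: nz; apply: gr_eq_trans t0.
by exists t', a; split=> //; apply: gr_eq_trans tt'.
Qed.

Lemma filt_exact g a : a \in filt_ge g -> a \notin filt_gt g -> a != 0 /\ v a = g.
Proof.
case/andP=> Ra /orP ga na.
have a0 : a != 0 by apply: contraNneq na => ->; apply: filt_gt0.
split=> //; case: ga => [/eqP e|ga]; first by rewrite e eqxx in a0.
apply/eqP; rewrite eq_sym; apply: contraNT na => gv.
by apply/andP; split=> //; apply/orP; right; rewrite lt_neqAle gv.
Qed.

Lemma gr_integral (x y : gr) : x * y = 0 -> (x == 0) || (y == 0).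
Proof.
elim/quotW: x => s; elim/quotW: y => t.
rewrite -![\pi _]/(gr_pi _) => st0; apply/orP.
have [|nx] := pselect (gr_eq s [::]); first by move=> /gr_piP ->; left.
have [|ny] := pselect (gr_eq t [::]); first by move=> /gr_piP ->; right.
have [s' [a [/gr_piP es sa sm]]] := gr_order nx.
have [t' [b [/gr_piP et tb tm]]] := gr_order ny.
move: st0; rewrite es et gr_piM => /(gr_piP _ [::])/(_ (a + b)).
rewrite {2}/hcomp big_nil subr0.
have -> : hcomp [seq hmul p q | p <- s', q <- t'] (a + b) = hcomp s' a * hcomp t' b.
  rewrite /hcomp big_mkcond big_allpairs_dep /= big_distrl [RHS]big_mkcond /=.
  apply: eq_big_seq => p /sm ap; case: ifPn => [/eqP ep|np].
    rewrite big_distrr [RHS]big_mkcond /=; apply: eq_bigr => q _.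
    by rewrite -[hdeg (hmul p q)]/(hdeg p + hdeg q) ep (inj_eq (addrI a)).
  rewrite big1_seq // => q /andP[_ /tm bq]; case: ifPn => // /eqP epq.
  have : a + b < hdeg p + hdeg q.
    by rewrite (addrC a b) (addrC (hdeg p)) oag_leD_lt // lt_neqAle (ap) eq_sym np.
  by rewrite -[hdeg p + hdeg q]/(hdeg (hmul p q)) epq ltxx.
have [sa0 va] := filt_exact (hcompP s' a) sa.
have [tb0 vb] := filt_exact (hcompP t' b) tb.
case/andP=> _; rewrite -topredE /= /val_gt mulf_eq0 (negPf sa0) (negPf tb0) /=.
by rewrite val_mul // va vb ltxx.
Qed.

Definition gr_unit : {pred gr} := fun x : gr => `[< exists y : gr, y * x = 1 >].
Definition gr_inv (x : gr) : gr :=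
  if pselect (exists y : gr, y * x = 1) is left h then projT1 (cid h) else x.

Lemma gr_mulVx : {in gr_unit, left_inverse 1 gr_inv *%R}.
Proof.
by move=> x /asboolP h; rewrite /gr_inv; case: pselect => // h'; case: cid.
Qed.
Lemma gr_unitPl (x y : gr) : y * x = 1 -> x \in gr_unit.
Proof. by move=> e; apply/asboolP; exists y. Qed.
Lemma gr_inv_out : {in [predC gr_unit], gr_inv =1 id}.
Proof. by move=> x /asboolP h; rewrite /gr_inv; case: pselect. Qed.
HB.instance Definition _ :=
  GRing.ComNzRing_hasMulInverse.Build gr gr_mulVx gr_unitPl gr_inv_out.
HB.instance Definition _ := GRing.ComUnitRing_isIntegral.Build gr gr_integral.

(* the class of a in P_g(R)/P_g^+(R), in degree g *)
Definition gr_cls g a : gr :=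
  gr_pi (if insub (g, a) is Some p then [:: p : hterm] else [::]).

Definition initial_form a : gr := gr_cls (v a) a.

Lemma gr_clsE g a (h : (g \in vgroup F) && (a \in filt_ge g)) :
  gr_cls g a = gr_pi [:: mk_hterm h].
Proof.
rewrite /gr_cls insubT; congr gr_pi; congr [:: _]; exact: val_inj.
Qed.

Lemma gr_cls_eq g a b : g \in vgroup F -> a \in filt_ge g -> b \in filt_ge g ->
  a - b \in filt_gt g -> gr_cls g a = gr_cls g b.
Proof.
move=> Gg Ra Rb ab.
have ha : (g \in vgroup F) && (a \in filt_ge g) by rewrite Gg.
have hb : (g \in vgroup F) && (b \in filt_ge g) by rewrite Gg.
rewrite (gr_clsE ha) (gr_clsE hb); apply/gr_piP => h.
rewrite /hcomp !big_cons !big_nil -[hdeg _]/g -[hdeg (mk_hterm hb)]/g.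
have [<-|_] := eqVneq g h; last by rewrite subrr filt_gt0.
by rewrite !addr0.
Qed.

Lemma gr_clsD g a b : g \in vgroup F -> a \in filt_ge g -> b \in filt_ge g ->
  gr_cls g (a + b) = gr_cls g a + gr_cls g b.
Proof.
move=> Gg Ra Rb.
have ha : (g \in vgroup F) && (a \in filt_ge g) by rewrite Gg.
have hb : (g \in vgroup F) && (b \in filt_ge g) by rewrite Gg.
have hab : (g \in vgroup F) && (a + b \in filt_ge g) by rewrite Gg filt_geD.
rewrite (gr_clsE ha) (gr_clsE hb) (gr_clsE hab) sumRingD; apply/gr_piP => h.
rewrite /hcomp !big_cons !big_nil.
rewrite -[hdeg (mk_hterm hab)]/g -[hdeg (mk_hterm ha)]/g -[hdeg (mk_hterm hb)]/g.
by have [_|_] := eqVneq g h; rewrite ?addr0 subrr filt_gt0.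
Qed.

Lemma gr_clsM g h a b : g \in vgroup F -> h \in vgroup F ->
  a \in filt_ge g -> b \in filt_ge h ->
  gr_cls (g + h) (a * b) = gr_cls g a * gr_cls h b.
Proof.
move=> Gg Gh Ra Rb.
have ha : (g \in vgroup F) && (a \in filt_ge g) by rewrite Gg.
have hb : (h \in vgroup F) && (b \in filt_ge h) by rewrite Gh.
have hab : (g + h \in vgroup F) && (a * b \in filt_ge (g + h)).
  by rewrite (rpredD Gg Gh) filt_geM.
rewrite (gr_clsE ha) (gr_clsE hb) (gr_clsE hab) gr_piM /=; congr (gr_pi [:: _]).
exact: hterm_eq.
Qed.

End Graded.

(* The natural map gr(R) -> gr(R') for R contained in R' and F contained in   *)
(* F', sending the class of a in degree g to the class of a in degree g.      *)
Section GradedMap.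
Variables (F F' : divringClosed L) (R R' : subringClosed L).

Definition hterms_lift : seq (hterm F R) -> seq (hterm F' R') :=
  pmap (fun p => insub (val p)).
Definition gr_map (x : gr F R) : gr F' R' := gr_pi (hterms_lift (repr x)).

Hypotheses (sFF' : {subset F <= F'}) (sRR' : {subset R <= R'}).

Lemma hcomp_lift s g : hcomp (hterms_lift s) g = hcomp s g.
Proof.
rewrite /hcomp /hterms_lift; elim: s => [|p s IH] /=; first by rewrite !big_nil.
have hp : ((val p).1 \in vgroup F') && ((val p).2 \in filt_ge R' (val p).1).
  have /andP[/asboolP[x /andP[Fx x0] vx] /andP[Rp vp]] := valP p.
  apply/andP; split; last by apply/andP; rewrite (sRR' Rp).
  by apply/asboolP; exists x => //; rewrite sFF'.
by rewrite insubT /= !big_cons IH.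
Qed.

Lemma gr_map_pi s : gr_map (gr_pi s) = gr_pi (hterms_lift s).
Proof.
apply/gr_piP => g; rewrite !hcomp_lift.
have /gr_piP/(_ g) : gr_pi (repr (gr_pi s)) = gr_pi s by rewrite /gr_pi reprK.
by move=> /andP[Rs vs]; apply/andP; rewrite (sRR' Rs).
Qed.

Lemma gr_map_zmod : zmod_morphism gr_map.
Proof.
have D (x y : gr F R) : gr_map (x + y) = gr_map x + gr_map y.
  elim/quotW: x => s; elim/quotW: y => t; rewrite sumRingD.
  rewrite -![\pi _]/(gr_pi _) !gr_map_pi sumRingD; apply/gr_piP => g.
  by rewrite hcomp_lift !hcomp_cat !hcomp_lift subrr filt_gt0.
by move=> a b; apply/eqP; rewrite eq_sym subr_eq -D subrK.
Qed.

Lemma hcompM (F0 : divringClosed L) (R0 : subringClosed L) (s t : seq (hterm F0 R0)) g :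
  hcomp [seq hmul p q | p <- s, q <- t] g
  = \sum_(q <- t) hcomp s (g - hdeg q) * hcoef q.
Proof.
rewrite /hcomp big_mkcond big_allpairs_dep /= exchange_big /=; apply: eq_bigr => q _.
rewrite -hcomp_mulr /hcomp big_map [RHS]big_mkcond.
by apply: eq_bigr.
Qed.

Lemma gr_map_monoid : monoid_morphism gr_map.
Proof.
split.
  rewrite -[1]/(gr_pi [:: hone F R]) gr_map_pi -[1]/(gr_pi [:: hone F' R']).
  by apply/gr_piP => g; rewrite hcomp_lift /hcomp !big_cons !big_nil subrr filt_gt0.
move=> x y; elim/quotW: x => s; elim/quotW: y => t.
rewrite -![\pi _]/(gr_pi _) gr_piM !gr_map_pi gr_piM; apply/gr_piP => g.
rewrite hcomp_lift !hcompM.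
rewrite (_ : \sum_(q <- hterms_lift t) _ = \sum_(q <- t) hcomp s (g - hdeg q) * hcoef q).
  by rewrite subrr filt_gt0.
rewrite /hterms_lift; elim: t => [|p t IH] /=; first by rewrite !big_nil.
have hp : ((val p).1 \in vgroup F') && ((val p).2 \in filt_ge R' (val p).1).
  have /andP[/asboolP[z /andP[Fz z0] vz] /andP[Rp vp]] := valP p.
  apply/andP; split; last by apply/andP; rewrite (sRR' Rp).
  by apply/asboolP; exists z => //; rewrite sFF'.
by rewrite insubT /= !big_cons IH hcomp_lift.
Qed.

Lemma gr_map_inj : injective gr_map.
Proof.
move=> x y; elim/quotW: x => s; elim/quotW: y => t.
rewrite -![\pi _]/(gr_pi _) !gr_map_pi => /gr_piP st; apply/gr_piP => g.
have := st g; rewrite !hcomp_lift => /andP[_ vst]; apply/andP; split=> //.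
have /andP[Rs _] := hcompP s g; have /andP[Rt _] := hcompP t g.
by rewrite rpredB.
Qed.

End GradedMap.

(* For R local and dominated by V_nu: R/m_R -> P_0(R)/P_0^+(R) in gr(R) *)
Section GradedResidue.
Variables (F : divringClosed L) (R : localSubring L).

Definition gr_res (_ : dominates (vring (whole L)) R) (c : res R) : gr F R :=
  gr_cls F R 0 (res_rep c).

Variable d : dominates (vring (whole L)) R.

Lemma dom_filt0 a : a \in R -> a \in filt_ge R 0.
Proof. by move=> Ra; rewrite -topredE /= /filt_ge Ra; have /andP[] := d.1 _ Ra. Qed.

Lemma dom_mx a : a \in R -> (a \in max_ideal R) = (a \in filt_gt R 0).
Proof.
by move=> Ra; rewrite -d.2 mx_vring Ra andbT /= -[RHS]topredE /= /filt_gt Ra.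
Qed.

Lemma gr_resE a : a \in R -> gr_res d (res_cls R a) = gr_cls F R 0 a.
Proof.
move=> Ra; apply: gr_cls_eq; rewrite ?dom_filt0 ?res_repP ?(rpred0 (vgroup F)) //.
by rewrite -dom_mx ?rpredB ?res_repP // -res_cls_eq ?res_repP // res_repK.
Qed.

Lemma gr_res_zmod : zmod_morphism (gr_res d).
Proof.
have D a b : gr_res d (a + b) = gr_res d a + gr_res d b.
  rewrite -[a]res_repK -[b]res_repK.
  have res_clsD x y : x \in R -> y \in R -> res_cls R x + res_cls R y = res_cls R (x + y).
    by move=> Rx Ry; rewrite -[y in RHS]opprK res_clsB ?rpredN // -[- y]sub0r res_clsB ?rpred0 // res_cls0 sub0r opprK.
  rewrite res_clsD ?res_repP // !gr_resE ?rpredD ?res_repP //.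
  by rewrite gr_clsD ?dom_filt0 ?res_repP ?(rpred0 (vgroup F)).
by move=> a b; apply/eqP; rewrite eq_sym subr_eq -D subrK.
Qed.

Lemma gr_res_monoid : monoid_morphism (gr_res d).
Proof.
split.
  rewrite -(res_cls1 R) gr_resE ?rpred1 //.
  by rewrite (gr_clsE (hone_proof F R)).
move=> a b; rewrite -[a]res_repK -[b]res_repK -res_clsM ?res_repP //.
rewrite !gr_resE ?rpredM ?res_repP // -{1}[0]addr0.
by rewrite gr_clsM ?dom_filt0 ?res_repP ?(rpred0 (vgroup F)).
Qed.

HB.instance Definition _ :=
  GRing.isZmodMorphism.Build (res R) (gr F R) (gr_res d) gr_res_zmod.
HB.instance Definition _ :=
  GRing.isMonoidMorphism.Build (res R) (gr F R) (gr_res d) gr_res_monoid.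

End GradedResidue.
End Valuation.

Definition rational_group (G : oagType) : Prop :=
  exists h : {additive G -> rat}, forall a b, (h a <= h b) = (a <= b).

Section Setup.
Variable L : fieldType.
Implicit Types (k F K : divringClosed L) (R S W : localSubring L).

Definition function_field k F : Prop :=
  exists n (x : 'I_n -> L), forall z,
    (z \in F) = (z \in field_gen [set y | y \in k \/ exists i, y = x i]).

Definition ess_finite_type k R : Prop :=
  exists n (x : 'I_n -> L) (M : {pred L}),
    let B := ring_gen [set y | y \in k \/ exists i, y = x i] in
    [/\ mulr_closed M, 0 \notin M, {subset M <= B} &
        forall z, z \in R <-> exists a m, [/\ a \in B, m \in M & z = a / m]].

Definition algebraic_local_ring k F R : Prop :=
  ess_finite_type k R /\
  forall z, z \in F <-> exists a b, [/\ a \in R, b \in R, b != 0 & z = a / b].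

Definition is_localization (B : subringClosed L) (q : prime_idealr (subr B)) R :=
  forall z, z \in R <-> exists a b : subr B, b \notin q /\ z = val a / val b.

(* R1 is a local ring of the blowup of a regular prime ideal P of R: the      *)
(* blowup is covered by the charts Spec R[P/f], for f a nonzero element of P. *)
Definition monoidal_transform R R1 : Prop :=
  exists (P : prime_idealr (subr R)) (f : subr R),
    [/\ exists d, regular_local_ring {ideal_quot P} d, f \in P, f != 0 &
      exists q : prime_idealr (subr (ring_gen
          [set y | y \in R \/ exists2 p : subr R, p \in P & y = val p / val f])),
        is_localization q R1].

Inductive monoidal_product W : localSubring L -> localSubring L -> Prop :=
| MonoidalId R : monoidal_product W R R
| MonoidalStep R R1 R2 of monoidal_product W R R1 & monoidal_transform R1 R2
    & dominates W R2 : monoidal_product W R R2.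

(* Includes that R is a two-dimensional regular local ring. *)
Definition regular_parameters R (u w : L) : Prop :=
  regular_local_ring (subr R) 2 /\
  forall z, z \in max_ideal R <-> exists a b, [/\ a \in R, b \in R & z = a * u + b * w].

Definition unit_in R (g : L) : Prop := [/\ g \in R, g != 0 & g^-1 \in R].

(* with exponent matrix diag(t, 1) *)
Definition strongly_monomial_in R S (u w x y : L) (t : nat) : Prop :=
  [/\ regular_parameters R u w, regular_parameters S x y, (0 < t)%N, w = y &
      exists2 g, unit_in S g & u = g * x ^+ t].

Definition strongly_monomial R S : Prop :=
  exists u w x y t, strongly_monomial_in R S u w x y t.

Definition exponent_mx (t : nat) : 'M[int]_2 :=
  \matrix_(i, j) if i == j then if i == 0 then t%:Z else 1 else 0.

Definition mx_lattice n (A : 'M[int]_n) : {pred 'cV[int]_n} :=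
  fun b => `[< exists c, b = A *m c >].

Lemma mx_lattice_zmod n (A : 'M[int]_n) : zmod_closed (mx_lattice A).
Proof.
split=> [|a b /asboolP[c ->] /asboolP[d ->]]; apply/asboolP.
  by exists 0; rewrite mulmx0.
by exists (c - d); rewrite mulmxBr.
Qed.
HB.instance Definition _ n (A : 'M[int]_n) :=
  GRing.isZmodClosed.Build 'cV[int]_n (mx_lattice A) (mx_lattice_zmod A).

Section Stable.
Variables (G : oagType) (v : valuation L G).

(* The valuation v is nu^* (with field L, value group G) and its restriction  *)
(* to K is nu.                                                                *)
Variable K : divringClosed L.
Let Vnu : localSubring L := vring v K.
Let Vnus : localSubring L := vring v (whole L).

Definition vgroup_index (e : nat) : Prop :=
  exists h : 'I_e -> Quotient.quot (vgroup v K), bijective h.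

Definition vgroup_iso (x y : L) (A : 'M[int]_2) : Prop :=
  exists phi : {additive Quotient.quot (mx_lattice A^T) -> Quotient.quot (vgroup v K)},
    bijective phi /\
    forall b : 'cV[int]_2,
      phi (\pi_(Quotient.quot (mx_lattice A^T)) b)
      = \pi_(Quotient.quot (vgroup v K)) (v x *~ b 0 0 + v y *~ b 1 0).

Definition stable R S : Prop :=
  strongly_monomial R S /\
  forall R1 S1 u1 w1 x1 y1 t1,
    monoidal_product Vnu R R1 -> monoidal_product Vnus S S1 ->
    dominates S1 R1 -> strongly_monomial_in R1 S1 u1 w1 x1 y1 t1 ->
    [/\ vgroup_iso x1 y1 (exponent_mx t1),
        is_join (res_image Vnus Vnu) (res_image Vnus S1) &
        linearly_disjoint (res_image Vnus Vnu) (res_image Vnus S1)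
          (res_image Vnus R1)].

(* gr_nu(R) (x)_{R/m_R} S/m_S *)
Section GradedTensor.
Variables (R S : localSubring L).
Variables (dS : dominates (vring v (whole L)) S) (dR : dominates S R).

Definition gr_tensor :=
  tensor (gr_res K (dominates_trans dS dR) : {rmorphism res R -> gr v K R})
         (res_map dR : {rmorphism res R -> res S}).
HB.instance Definition _ := GRing.ComNzRing.on gr_tensor.

Definition gr_tens (a : gr v K R) (b : res S) : gr_tensor := tens _ _ a b.
End GradedTensor.

End Stable.
End Setup.

(* Main.v *)
Require Import Defs.
From HB Require Import structures.
From mathcomp Require Import all_boot all_order all_algebra.
From mathcomp Require Import boolp classical_sets.
From mathcomp Require Import separable.
From mathcomp Require Import ring.
From mathcomp Require Import ring_quotient qpoly fraction generic_quotient mpoly.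

(* The value of x generates the value group of nu^* modulo that of nu, with   *)
(* order e, and linear disjointness provides s_1, ..., s_f in S whose         *)
(* residues form a basis of S/m_S over R/m_R and stay independent over        *)
(* V_nu/m_nu.  Hence in a sum of terms a_ij s_j x^i with a_ij in K and i < e  *)
(* the values do not cancel.  On the other hand S = M + m_R S for             *)
(* M = sum R s_j x^i, since m_R S = (x^e, y); iterating, S = M + m_R^N S for  *)
(* all N, so by the archimedean property every element of S has the same      *)
(* initial form as an element of M.  Thus the initial forms of the s_j x^i    *)
(* are a basis of gr(S) over gr(R) with e f elements.                         *)

Set Implicit Arguments.
Unset Strict Implicit.
Unset Printing Implicit Defensive.

Import Order.TTheory GRing.Theory.
Local Open Scope classical_set_scope.
Local Open Scope ring_scope.
Local Open Scope quotient_scope.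

(** Both conclusions follow from one fact: the initial forms of the monomials s_j x^i, for i < e and
    j < f, are a basis of gr(S) over gr(R) ([gr_monomial_free], [gr_monomial_span]). Stability,
    applied to R -> S itself, supplies what independence needs: [exponent_cosets] separates the
    multiples of the value of x modulo the value group of nu, and [join_basis] finds the s_j. Then
    values of monomial sums cannot cancel ([monomial_indep_gt]). Spanning comes from
    [monomial_generation], iterated in [approximation].

    For the presentation, let xi be the initial form of x, so that xi^e = [gamma0]^-1 [u]. Grouping
    the basis by powers of xi shows that gr(S) is free on 1, xi, ..., xi^(e-1) over the tensor
    product T ([tensor_presentation]), and such a ring is T[Z]/(Z^e - c) ([qpoly_presentation]).

    For the degree, a finite basis of a domain over a subdomain remains a basis between the fraction
    fields, because every nonzero element divides a nonzero element of the subdomain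
    ([free_over_dvd], [has_degree_frac]). *)

Definition free_over (A B : nzRingType) (i : A -> B) (I : finType) (b : I -> B) : Prop :=
  forall c : I -> A, \sum_l i (c l) * b l = 0 -> forall l, c l = 0.

Definition in_span (A B : nzRingType) (i : A -> B) (I : finType) (b : I -> B) (z : B) : Prop :=
  exists c : I -> A, z = \sum_l i (c l) * b l.

(** * Spans and free families along a ring homomorphism *)

Section Span.
Variables (A B : comNzRingType) (i : {rmorphism A -> B}).

Lemma in_span0 (I : finType) (b : I -> B) : in_span i b 0.
Proof. by exists (fun=> 0); rewrite big1 // => l _; rewrite rmorph0 mul0r. Qed.

Lemma in_spanD (I : finType) (b : I -> B) z t :
  in_span i b z -> in_span i b t -> in_span i b (z + t).
Proof.
move=> [c ->] [d ->]; exists (fun l => c l + d l); rewrite -big_split /=.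
by apply: eq_bigr => l _; rewrite rmorphD mulrDl.
Qed.

Lemma in_spanZ (I : finType) (b : I -> B) a z :
  in_span i b z -> in_span i b (i a * z).
Proof.
move=> [c ->]; exists (fun l => a * c l); rewrite mulr_sumr.
by apply: eq_bigr => l _; rewrite rmorphM mulrA.
Qed.

Lemma in_spanN (I : finType) (b : I -> B) z : in_span i b z -> in_span i b (- z).
Proof. by move=> /(in_spanZ (-1)); rewrite rmorphN rmorph1 mulN1r. Qed.

Lemma in_span_sum (I : finType) (b : I -> B) (J : Type) (r : seq J) (F : J -> B) :
  (forall j, in_span i b (F j)) -> in_span i b (\sum_(j <- r) F j).
Proof. by move=> h; elim/big_ind: _ => // *; [apply: in_span0|apply: in_spanD]. Qed.

Lemma in_span_mem (I : finType) (b : I -> B) l : in_span i b (b l).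
Proof.
exists (fun m => (m == l)%:R); rewrite (bigD1 l) //= eqxx rmorph1 mul1r big1 ?addr0 //.
by move=> m /negPf ->; rewrite rmorph0 mul0r.
Qed.

Lemma in_span_trans (I J : finType) (b : I -> B) (b' : J -> B) z :
  in_span i b z -> (forall l, in_span i b' (b l)) -> in_span i b' z.
Proof. by move=> [c ->] h; apply: in_span_sum => l; apply: in_spanZ. Qed.

Lemma in_spanM (I : finType) (b : I -> B) z t :
  (forall l m, in_span i b (b l * b m)) -> in_span i b z -> in_span i b t ->
  in_span i b (z * t).
Proof.
move=> h [c ->] [d ->]; rewrite mulr_suml; apply: in_span_sum => l.
rewrite -mulrA; apply: in_spanZ; rewrite mulr_sumr; apply: in_span_sum => m.
by rewrite mulrCA; apply: in_spanZ.
Qed.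

Lemma free_over_reindex (I J : finType) (h : J -> I) (b : I -> B) :
  bijective h -> free_over i b -> free_over i (b \o h).
Proof.
move=> [h' hK h'K] fb c e l; rewrite -[l]hK; apply: (fb (c \o h')).
rewrite (reindex h) /=; last by exists h' => ? _.
by rewrite -[RHS]e; apply: eq_bigr => m _; rewrite hK.
Qed.

Lemma in_span_reindex (I J : finType) (h : J -> I) (b : I -> B) z :
  bijective h -> in_span i b z -> in_span i (b \o h) z.
Proof.
move=> [h' hK h'K] [c ->]; exists (c \o h); rewrite (reindex h) //=.
by exists h' => ? _.
Qed.

Lemma free_over_inj (I : finType) (b : I -> B) (c d : I -> A) :
  free_over i b -> \sum_l i (c l) * b l = \sum_l i (d l) * b l -> c =1 d.
Proof.
move=> fb e l; apply/eqP; rewrite -subr_eq0; apply/eqP; move: l.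
apply: (fb (fun l => c l - d l)).
by under eq_bigr => l _ do rewrite rmorphB mulrBl; rewrite sumrB e subrr.
Qed.
End Span.

(** * Finite free extensions of domains and the determinant trick *)

Section FreeDomain.
Variables (A B : idomainType) (i : {rmorphism A -> B}).

(** [M] is the matrix of multiplication by z. A vector w with wM = 0 gives z times the combination w
    of the b_l equal to 0, so w = 0 by freeness; the second claim is the identity adj(M) M =
    det(M). *)
Lemma free_over_det n (b : 'I_n -> B) (z : B) (M : 'M[A]_n) :
  free_over i b -> z != 0 -> (forall l, z * b l = \sum_m i (M l m) * b m) ->
  \det M != 0 /\ forall l, i (\det M) * b l = z * \sum_m i (\adj M l m) * b m.
Proof.
move=> fb z0 zb; split.
  apply/det0P => -[w w0 wM]; case/negP: w0; apply/eqP/rowP => m; rewrite mxE.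
  apply: (fb (w 0)); apply: (mulfI z0); rewrite mulr0 mulr_sumr.
  under eq_bigr => l _ do rewrite mulrCA zb mulr_sumr.
  rewrite exchange_big big1 //= => l _.
  under eq_bigr => j _ do rewrite mulrA -rmorphM.
  rewrite -mulr_suml -rmorph_sum; move/rowP/(_ l): wM; rewrite !mxE => ->.
  by rewrite rmorph0 mul0r.
move=> l; rewrite mulr_sumr.
under eq_bigr => m _ do rewrite mulrCA zb mulr_sumr.
rewrite exchange_big /= (bigD1 l) //= [X in _ + X]big1 ?addr0 => [|j jl].
  under eq_bigr => j _ do rewrite mulrA -rmorphM.
  rewrite -mulr_suml -rmorph_sum; have /matrixP/(_ l l) := mul_adj_mx M.
  by rewrite !mxE eqxx mulr1n => ->.
under eq_bigr => m _ do rewrite mulrA -rmorphM.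
rewrite -mulr_suml -rmorph_sum; have /matrixP/(_ l j) := mul_adj_mx M.
by rewrite !mxE eq_sym (negPf jl) mulr0n => ->; rewrite rmorph0 mul0r.
Qed.

(** The norm of z is a multiple of z: expand 1 in the family and apply the adjugate identity to each
    term. This replaces denominators in B by denominators in A. *)
Lemma free_over_dvd n (b : 'I_n -> B) (z : B) :
  free_over i b -> (forall l, in_span i b (z * b l)) -> in_span i b 1 -> z != 0 ->
  exists2 d, d != 0 & exists2 t, in_span i b t & i d = z * t.
Proof.
move=> fb zb [c e1] z0.
have [M zM] := choice zb; pose M' : 'M[A]_n := \matrix_(l, m) M l m.
have [|dM e] := @free_over_det n b z M' fb z0.
  by move=> l; rewrite zM; apply: eq_bigr => m _; rewrite mxE.
exists (\det M') => //.
exists (\sum_l i (c l) * \sum_m i (\adj M' l m) * b m).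
  by apply: in_span_sum => l; apply: in_spanZ; exists (fun m => \adj M' l m).
rewrite -[LHS]mulr1 {1}e1 !mulr_sumr; apply: eq_bigr => l _.
by rewrite mulrCA e mulrCA.
Qed.
End FreeDomain.

(** * Degree of the extension of fraction fields *)

Section FractionDegree.
Variables (A B : idomainType) (i : {rmorphism A -> B}).
Local Notation "x %:F" := (FracField.tofrac x).

Lemma frac_repr (z : {fraction B}) : exists a b, b != 0 /\ z = a%:F / b%:F.
Proof.
elim/quotW: z => x; exists (\n_x), (\d_x); rewrite denom_ratioP; split=> //.
have -> : \pi_({fraction B}) x = FracField.mul (\n_x)%:F (FracField.inv (\d_x)%:F).
  rewrite !piE; apply/eqmodP; rewrite /= FracField.equivfE.
  rewrite /FracField.mulf /FracField.invf !numden_Ratio ?oner_neq0 ?denom_ratioP //.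
    by rewrite mulr1 mul1r mulrC.
  1,2: by rewrite mul1r denom_ratioP.
by [].
Qed.

Hypothesis i_inj : injective i.

Let i_neq0 d : d != 0 -> i d != 0.
Proof. by rewrite -(rmorph0 i) (inj_eq i_inj). Qed.

(** Independence survives localization by clearing a common denominator. For spanning, the
    denominator of a fraction is first made an element of A by [free_over_dvd], and the new
    numerator is then expanded in the basis. *)
Lemma has_degree_frac (I : finType) (b : I -> B) :
  free_over i b -> (forall z, in_span i b z) ->
  has_degree (frac_image (i : A -> B)) #|I|.
Proof.
move=> fb sb; pose b' (l : 'I_#|I|) := b (enum_val l).
have bij : bijective (@enum_val I I) by exists enum_rank; [apply: enum_valK|apply: enum_rankK].
have {}fb : free_over i b' by apply: (free_over_reindex bij).
have {}sb z : in_span i b' z by apply: (in_span_reindex bij).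
have fracP (c : 'I_#|I| -> {fraction B}) : (forall l, c l \in frac_image (i : A -> B)) ->
    exists (n : 'I_#|I| -> A) (d : A), d != 0 /\ forall l, c l = (i (n l))%:F / (i d)%:F.
  move=> hc; have /choice[a ha] l : exists p : A * A, p.2 != 0 /\ c l = (i p.1)%:F / (i p.2)%:F.
    by have /asboolP[a [d [d0 ->]]] := hc l; exists (a, d).
  (* The common denominator is the product of all denominators; each numerator is multiplied by the
     others. *)
  exists (fun l => (a l).1 * \prod_(m | m != l) (a m).2), (\prod_m (a m).2); split.
    by apply/prodf_neq0 => m _; have [] := ha m.
  move=> l; have [al ->] := ha l; rewrite [\prod_m _](bigD1 l) //= !rmorphM /=.
  rewrite -mulf_div divff ?mulr1 // tofrac_eq0 i_neq0 //.
  by apply/prodf_neq0 => m _; have [] := ha m.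
have frac_free c : (forall l, c l \in frac_image (i : A -> B)) ->
    \sum_l c l * (b' l)%:F = 0 -> forall l, c l = 0.
  move=> /fracP[n [d [d0 cE]]] e l; rewrite cE (fb n) ?rmorph0 ?mul0r //.
  apply/eqP; rewrite -tofrac_eq0 rmorph_sum; apply/eqP.
  have id0 : (i d)%:F != 0 by rewrite tofrac_eq0 i_neq0.
  apply: (mulIf (invr_neq0 id0)); rewrite mul0r mulr_suml -[RHS]e.
  by apply: eq_bigr => m _; rewrite /= tofracM cE mulrAC.
exists (fun l => (b' l)%:F) => z.
have [a [t [t0 ->]]] := frac_repr z.
have [d d0 [t' _ dt]] : exists2 d, d != 0 & exists2 t', in_span i b' t' & i d = t * t'.
  by apply: free_over_dvd => // l.
have [n nE] := sb (a * t').
pose c : {ffun 'I_#|I| -> {fraction B}} := [ffun l => (i (n l))%:F / (i d)%:F].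
have cF l : c l \in frac_image (i : A -> B).
  by apply/asboolP; exists (n l), d; rewrite ffunE.
have t'0 : t' != 0 by apply: contraNneq (i_neq0 d0) => e; rewrite dt e mulr0.
have cE : a%:F / t%:F = \sum_l c l * (b' l)%:F.
  under eq_bigr => l _ do rewrite ffunE mulrAC -tofracM.
  rewrite -mulr_suml -rmorph_sum -nE dt !rmorphM /= -mulf_div.
  by rewrite divff ?mulr1 // tofrac_eq0.
exists c; split=> // c' [c'F c'E]; apply/ffunP => l; apply/eqP; rewrite -subr_eq0.
apply/eqP; apply: (frac_free (fun l => c l - c' l)) => [m|].
  have /asboolP[p [q [q0 ->]]] := c'F m; apply/asboolP.
  exists (n m * q - p * d), (d * q); rewrite mulf_neq0 //; split=> //.
  rewrite ffunE -mulNr addf_div ?tofrac_eq0 ?i_neq0 // !rmorphM rmorphB !rmorphM /=.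
  by rewrite mulNr tofracB !tofracM.
by under eq_bigr => m _ do rewrite mulrBl; rewrite sumrB -cE -c'E subrr.
Qed.
End FractionDegree.

(** * Finite-dimensional spaces over a field *)

Section FieldSpan.
Variables (F E : fieldType) (i : {rmorphism F -> E}).

(** A family of least size whose span contains the c_l is free, since a nontrivial relation would
    express one member by the others and allow dropping it. *)
Lemma spanning_basis n (c : 'I_n -> E) :
  exists m (x : 'I_m -> E), free_over i x /\ forall l, in_span i x (c l).
Proof.
have ex : exists m, `[< exists x : 'I_m -> E, forall l, in_span i x (c l) >].
  by exists n; apply/asboolP; exists c => l; apply: in_span_mem.
case: (ex_minnP ex) => m /asboolP[x sx] mmin; exists m, x; split=> // d e l.
apply/eqP/negPn/negP => dl.
case: m => [|m] in x sx mmin d e l dl *; first by case: l {dl}.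
suff : (m < m)%N by rewrite ltnn.
apply: mmin; apply/asboolP; exists (x \o lift l) => k.
apply: in_span_trans (sx k) _ => j; case: (unliftP l j) => [j' ->|->].
  exact: (in_span_mem i (x \o lift l)).
have -> : x l = i (- (d l)^-1) * \sum_j i (d (lift l j)) * x (lift l j).
  move: e; rewrite (bigD1_ord l) //= => /eqP; rewrite addr_eq0 => /eqP e.
  by rewrite rmorphN mulNr -mulrN -e mulrA -rmorphM mulVf // rmorph1 mul1r.
by apply: in_spanZ; exists (fun j => d (lift l j)).
Qed.

Lemma free_over_extend n (x : 'I_n -> E) z : free_over i x -> ~ in_span i x z ->
  free_over i (fun k : 'I_n.+1 => oapp x z (unlift ord0 k)).
Proof.
move=> fx nz c; rewrite big_ord_recl unlift_none /=.
under eq_bigr => l _ do rewrite liftK /=.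
move=> e; have c0 : c ord0 = 0.
  apply/eqP/negPn/negP => c0; apply: nz.
  have -> : z = i (- (c ord0)^-1) * \sum_(l < n) i (c (lift ord0 l)) * x l.
    move/eqP: e; rewrite addr_eq0 => /eqP e.
    by rewrite rmorphN mulNr -mulrN -e mulrA -rmorphM mulVf // rmorph1 mul1r.
  by apply: in_spanZ; exists (fun l => c (lift ord0 l)).
move: e; rewrite c0 rmorph0 mul0r add0r => /(fx (fun l => c (lift ord0 l))) cl k.
by case: (unliftP ord0 k) => [j ->|->].
Qed.

(** The coordinate matrix of the x_l has zero left kernel, so its rank is n. *)
Lemma free_over_leq n m (x : 'I_n -> E) (b : 'I_m -> E) :
  free_over i x -> (forall l, in_span i b (x l)) -> (n <= m)%N.
Proof.
move=> fx /choice[M xM]; pose N : 'M[F]_(n, m) := \matrix_(l, j) M l j.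
suff /eqP <- : row_free N by apply: rank_leq_col.
rewrite -kermx_eq0; apply/eqP/row_matrixP => r; rewrite row0; apply/rowP => l.
rewrite [RHS]mxE; set w := row r (kermx N).
have wN : w *m N = 0 by apply/sub_kermxP; apply: row_sub.
move: l; apply: (fx (w 0)); under eq_bigr => k _ do rewrite xM mulr_sumr.
rewrite exchange_big big1 //= => j _.
under eq_bigr => k _ do rewrite mulrA -rmorphM.
rewrite -mulr_suml -rmorph_sum; move/rowP/(_ j): wN; rewrite mxE [RHS]mxE.
by under eq_bigr => k _ do rewrite [N _ _]mxE; move=> ->; rewrite rmorph0 mul0r.
Qed.

(** A finite-dimensional algebra without zero divisors is a field: a nonzero t divides a nonzero
    scalar by [free_over_dvd], and the scalar is invertible. *)
Lemma span_field n (x : 'I_n -> E) : free_over i x -> in_span i x 1 ->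
  (forall l m, in_span i x (x l * x m)) -> divring_closed (fun z => `[< in_span i x z >]).
Proof.
move=> fx x1 xM; split=> [|z t /asboolP hz /asboolP ht|z t /asboolP hz /asboolP ht].
- exact/asboolP.
- by apply/asboolP/in_spanD => //; apply: in_spanN.
- have [->|t0] := eqVneq t 0; first by rewrite invr0 mulr0; apply/asboolP/in_span0.
  have [l|d d0 [t' ht' e]] := free_over_dvd fx _ x1 t0.
    by apply: in_spanM => //; apply: in_span_mem.
  have -> : z / t = i d^-1 * (z * t').
    have id0 : i d != 0 by rewrite fmorph_eq0.
    by rewrite fmorphV; apply: (mulfI id0); rewrite mulVKf // e mulrAC [t * _]mulrCA divff // mulr1.
  by apply/asboolP/in_spanZ/in_spanM.
Qed.
End FieldSpan.

(** * Linear disjointness and bases of a join *)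

Section LinearlyDisjoint.
Variables (E FA FB FC : fieldType).
Variables (iA : {rmorphism FA -> E}) (iB : {rmorphism FB -> E}).
Variables (jA : {rmorphism FC -> FA}) (jB : {rmorphism FC -> FB}).
Hypothesis jAB : forall c, iA (jA c) = iB (jB c).
Variables (A B C : {pred E}).
Hypothesis AP : forall z, z \in A <-> exists a, z = iA a.
Hypothesis BP : forall z, z \in B <-> exists b, z = iB b.
Hypothesis CP : forall z, z \in C <-> exists c, z = iA (jA c).

(* The definition of linear disjointness is asymmetric in A and B; this is    *)
(* the other direction.                                                       *)
Lemma disjoint_free n (y : 'I_n -> FB) :
  linearly_disjoint A B C -> free_over jB y -> free_over iA (iB \o y).
Proof.
(* The c_l are expanded in a family [x] free over FC. Disjointness makes [x] independent over B, so
   regrouping the relation by the members of [x] leaves relations among the y_l with coefficients in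
   FC. *)
move=> dis fy c e; have [m [x [fx sx]]] := spanning_basis jA c.
have [d dE] := choice sx.
have xB : linearly_independent B (iA \o x).
  apply: dis => [k|c' c'C e']; first by apply/AP; exists (x k).
  have [a aE] := choice (fun k => (CP (c' k)).1 (c'C k)).
  move=> k; rewrite aE fx ?rmorph0 //; apply: (fmorph_inj iA).
  rewrite rmorph0 rmorph_sum -[RHS]e'.
  by apply: eq_bigr => j _; rewrite rmorphM aE.
have d0 l k : d l k = 0.
  move: l; apply: fy; apply: (fmorph_inj iB); rewrite rmorph0.
  move: k; apply: xB => [k|]; first by apply/BP; eexists.
  rewrite -[RHS]e /=; under eq_bigr => k _ do rewrite rmorph_sum mulr_suml.
  rewrite exchange_big; apply: eq_bigr => l _ /=.
  rewrite dE rmorph_sum mulr_suml; apply: eq_bigr => k _.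
  by rewrite !rmorphM jAB mulrAC.
by move=> l; rewrite dE big1 // => k _; rewrite d0 rmorph0 mul0r.
Qed.

(** Take a largest family in FB free over FC; its size is bounded by f because it stays free over
    FA. By maximality it spans FB, so its span over FA is a ring containing A and B. Being finite
    over FA, this ring is a field, hence all of E as E is the join, and the size is exactly f. *)
Lemma join_basis f : has_degree A f -> is_join A B -> linearly_disjoint A B C ->
  exists s : 'I_f -> FB, free_over iA (iB \o s) /\ forall t, in_span jB s t.
Proof.
move=> [b bP] join dis.
have A0 : 0 \in A by apply/AP; exists 0; rewrite rmorph0.
have fb : free_over iA b.
  move=> c e l; have [d [_ uniq]] := bP 0.
  have c0 : d = [ffun=> 0].
    by apply: uniq; split=> [k|]; rewrite ?ffunE // big1 // => k _; rewrite ffunE mul0r.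
  have cE : d = [ffun k => iA (c k)].
    apply: uniq; split=> [k|]; first by rewrite ffunE; apply/AP; exists (c k).
    by rewrite -[LHS]e; apply: eq_bigr => k _; rewrite ffunE.
  by move: cE; rewrite c0 => /ffunP/(_ l); rewrite !ffunE => /esym/eqP; rewrite fmorph_eq0 => /eqP.
have sb z : in_span iA b z.
  have [d [[dA ->] _]] := bP z; have [a aE] := choice (fun k => (AP (d k)).1 (dA k)).
  by exists a; apply: eq_bigr => k _; rewrite aE.
pose P n := `[< exists s : 'I_n -> FB, free_over jB s >].
have exP : exists n, P n by exists 0; apply/asboolP; exists (fun=> 0) => c _ [].
have leP n : P n -> (n <= f)%N.
  by move=> /asboolP[s fs]; apply: free_over_leq (disjoint_free dis fs) _ => l.
case: (ex_maxnP exP leP) => n /asboolP[s fs] nmax.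
have ss t : in_span jB s t.
  apply: contrapT => nt; suff : (n < n)%N by rewrite ltnn.
  by apply: nmax; apply/asboolP; eexists; apply: free_over_extend fs nt.
have fAs := disjoint_free dis fs.
have sB t : in_span iA (iB \o s) (iB t).
  have [c ->] := ss t; exists (fun l => jA (c l)); rewrite rmorph_sum.
  by apply: eq_bigr => l _; rewrite rmorphM jAB.
have D_divring : divring_closed (fun z => `[< in_span iA (iB \o s) z >]).
  apply: span_field => // [|l m]; first by rewrite -(rmorph1 iB).
  by rewrite /= -rmorphM.
pose D := HB.pack_for (divringClosed E) (fun z => `[< in_span iA (iB \o s) z >])
  (GRing.isDivringClosed.Build E _ D_divring).
have sE z : in_span iA (iB \o s) z.
  have /asboolP/(_ D) := join z => h; apply/asboolP; apply: h => t [/AP[a ->]|/BP[b' ->]].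
    apply/asboolP; rewrite -[iA a]mulr1; apply: in_spanZ; rewrite -(rmorph1 iB).
    exact: sB.
  exact/asboolP.
have fn : f = n.
  by apply/eqP; rewrite eqn_leq leP ?andbT; [exact: free_over_leq fb _|apply/asboolP; exists s].
by subst f; exists s.
Qed.
End LinearlyDisjoint.

(** * Ordered groups and the archimedean property *)

Section OrderedGroup.
Variable G : oagType.
Implicit Types g h : G.

Lemma oag_argmin (I : finType) (P : pred I) (F : I -> G) p0 : P p0 ->
  exists2 p, P p & forall q, P q -> F p <= F q.
Proof.
move=> Pp0; suff [p [Pp pm]] : exists p, P p /\ {in enum I, forall q, P q -> F p <= F q}.
  by exists p => // q; apply: pm; rewrite mem_enum.
elim: (enum I) => [|q s [p [Pp pm]]]; first by exists p0.
have [Pq|nPq] := boolP (P q); last first.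
  exists p; split=> // r; rewrite inE => /orP[/eqP ->|/pm //].
  by rewrite (negPf nPq).
case/orP: (oag_total (F p) (F q)) => pq.
  by exists p; split=> // r; rewrite inE => /orP[/eqP ->|/pm].
exists q; split=> // r; rewrite inE => /orP[/eqP -> //|/pm h /h].
exact: le_trans.
Qed.

Lemma rational_archimedean g h : rational_group G -> 0 < h -> exists n, g < h *+ n.
Proof.
move=> [f fle] h0.
have flt a b : (f a < f b) = (a < b).
  by rewrite oag_ltNge -fle
  -Num.Theory.real_ltNge ?Num.Theory.num_real.
have fh0 : 0 < f h by rewrite -(raddf0 f) flt.
have [n ng] : exists n, f g < f h *+ n.
  exists (Num.bound `|f g / f h|); rewrite -mulr_natl -Num.Theory.ltr_pdivrMr //.
  apply: le_lt_trans (Num.Theory.ler_norm _) _.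
  exact: (Num.Theory.archi_boundP (Num.Theory.normr_ge0 _)).
by exists n; rewrite -flt raddfMn.
Qed.
End OrderedGroup.

(** * Values of sums and powers *)

Section ValuationTheory.
Variables (L : fieldType) (G : oagType) (v : valuation L G).

Lemma val_gt_sum (I : Type) (r : seq I) (P : pred I) (F : I -> L) g :
  (forall i, P i -> F i \in val_gt v g) -> \sum_(i <- r | P i) F i \in val_gt v g.
Proof.
by move=> h; elim/big_ind: _ => //; [apply: val_gt0|move=> *; apply: val_gtD].
Qed.

Lemma val_exp z n : z != 0 -> v (z ^+ n) = v z *+ n.
Proof.
move=> z0; elim: n => [|n IH]; first by rewrite expr0 Defs.val1 mulr0n.
by rewrite exprS val_mul ?expf_neq0 // IH mulrS.
Qed.

Lemma val_ge_refl z : z \in val_ge v (v z).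
Proof. by rewrite -topredE /= /val_ge lexx orbT. Qed.

Lemma val_ge_le g h z : h <= g -> z \in val_ge v g -> z \in val_ge v h.
Proof.
by move=> hg /orP[z0|gz]; apply/orP; [left|right; apply: le_trans gz].
Qed.

Lemma val_ge_lt g h z : h < g -> z \in val_ge v g -> z \in val_gt v h.
Proof.
move=> hg /orP[/eqP->|gz]; first exact: val_gt0.
by apply/orP; right; apply: lt_le_trans gz.
Qed.

Lemma val_ge_exact g z : z \in val_ge v g -> z \notin val_gt v g -> z != 0 /\ v z = g.
Proof.
move=> /orP ge ngt; have z0 : z != 0 by apply: contraNneq ngt => ->; apply: val_gt0.
split=> //; case: ge => [/eqP e|ge]; first by rewrite e eqxx in z0.
apply/eqP; rewrite eq_sym; apply: contraNT ngt => ne.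
by apply/orP; right; rewrite lt_neqAle ne.
Qed.

Lemma val_ge_exp g z n : z \in val_ge v g -> z ^+ n \in val_ge v (g *+ n).
Proof.
move=> hz; elim: n => [|n IH]; last by rewrite exprS mulrS val_geM.
by rewrite expr0 mulr0n -(Defs.val1 v) val_ge_refl.
Qed.

(** * Homogeneous components of the associated graded ring *)

Section GradedComponents.
Variables (F : divringClosed L) (R : subringClosed L).
Implicit Types (g h : G) (s t : gr v F R).

(* A representative of the degree g component; it is only meaningful modulo   *)
(* elements of value greater than g.                                          *)
Definition gcomp s g : L := hcomp (repr s) g.

Lemma gcompP s g : gcomp s g \in filt_ge v R g.
Proof. exact: hcompP. Qed.

Lemma gcomp_pi p g : gcomp (gr_pi p : gr v F R) g - hcomp p g \in val_gt v g.
Proof.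
have /gr_piP/(_ g) : gr_pi (repr (gr_pi p : gr v F R)) = gr_pi p by rewrite /gr_pi reprK.
by case/andP.
Qed.

Lemma gcomp_eq s t : (forall g, gcomp s g - gcomp t g \in val_gt v g) -> s = t.
Proof.
move=> h; rewrite -[s]reprK -[t]reprK; apply/(gr_piP (repr s) (repr t)) => g.
apply/andP; split; last exact: h.
by have /andP[? _] := gcompP s g; have /andP[? _] := gcompP t g; apply: rpredB.
Qed.

Lemma gcompD s t g : gcomp (s + t) g - (gcomp s g + gcomp t g) \in val_gt v g.
Proof.
by have := gcomp_pi (repr s ++ repr t) g; rewrite hcomp_cat /gr_pi -sumRingD !reprK.
Qed.

Lemma gcomp0 g : gcomp 0 g \in val_gt v g.
Proof. by have := gcomp_pi [::] g; rewrite /hcomp big_nil subr0. Qed.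

Lemma gcomp_sum (I : Type) (r : seq I) (P : pred I) (E : I -> gr v F R) g :
  gcomp (\sum_(i <- r | P i) E i) g - \sum_(i <- r | P i) gcomp (E i) g \in val_gt v g.
Proof.
elim: r => [|i r IH]; first by rewrite !big_nil subr0 gcomp0.
rewrite !big_cons; case: (P i) => //.
rewrite -(subrKA (gcomp (E i) g + gcomp (\sum_(i <- r | P i) E i) g)).
apply: val_gtD; first exact: gcompD.
by rewrite opprD addrACA subrr add0r.
Qed.

Lemma gcompM_cls s h b g : h \in vgroup v F -> b \in filt_ge v R h ->
  gcomp (s * gr_cls v F R h b) g - gcomp s (g - h) * b \in val_gt v g.
Proof.
move=> Fh Rb; have hb : (h \in vgroup v F) && (b \in filt_ge v R h) by rewrite Fh.
rewrite (gr_clsE hb) -[X in _ - X](hcomp_mulr (repr s) (mk_hterm hb) g).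
have <- : [seq hmul p q | p <- repr s, q <- [:: mk_hterm hb]] =
          [seq hmul p (mk_hterm hb) | p <- repr s].
  by elim: (repr s) => //= p r ->.
by have := gcomp_pi [seq hmul p q | p <- repr s, q <- [:: mk_hterm hb]] g;
  rewrite -gr_piM /gr_pi reprK.
Qed.

Lemma gr_cls0 g a : g \in vgroup v F -> a \in filt_gt v R g -> gr_cls v F R g a = 0.
Proof.
move=> Fg /andP[Ra va]; rewrite (@gr_cls_eq _ _ _ F R g a 0) ?filt_ge0 //.
- have h0 : (g \in vgroup v F) && (0 \in filt_ge v R g) by rewrite Fg filt_ge0.
  apply: (@addrI _ (gr_cls v F R g 0)).
  by rewrite -gr_clsD ?filt_ge0 // !addr0.
- by apply/andP; rewrite Ra val_gtW.
- by rewrite subr0; apply/andP.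
Qed.

Lemma gr_cls_sum g (I : Type) (r : seq I) (E : I -> L) : g \in vgroup v F ->
  (forall i, E i \in filt_ge v R g) ->
  gr_cls v F R g (\sum_(i <- r) E i) = \sum_(i <- r) gr_cls v F R g (E i).
Proof.
move=> Fg hE; elim: r => [|i r IH]; first by rewrite !big_nil gr_cls0 ?filt_gt0.
rewrite !big_cons -IH gr_clsD //.
by elim/big_ind: _ => //; [apply: filt_ge0|move=> *; apply: filt_geD].
Qed.

Lemma gr_ind (P : gr v F R -> Prop) :
  P 0 -> (forall s t, P s -> P t -> P (s + t)) ->
  (forall g a, g \in vgroup v F -> a \in filt_ge v R g -> P (gr_cls v F R g a)) ->
  forall s, P s.
Proof.
move=> P0 PD Pcls; elim/quotW => s; elim: s => [//|p s IH].
have := PD _ _ (Pcls _ _ (hdegP p) (hcoefP p)) IH.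
have hp : (hdeg p \in vgroup v F) && (hcoef p \in filt_ge v R (hdeg p)).
  by rewrite hdegP hcoefP.
by rewrite (gr_clsE hp) sumRingD (_ : mk_hterm hp = p) //; apply: hterm_eq.
Qed.

Lemma gr_clsX g a n : g \in vgroup v F -> a \in filt_ge v R g ->
  gr_cls v F R g a ^+ n = gr_cls v F R (g *+ n) (a ^+ n).
Proof.
move=> Fg Ra; elim: n => [|n IH].
  by rewrite !expr0 mulr0n (gr_clsE (hone_proof v F R)).
rewrite exprS IH -gr_clsM ?rpredMn -?mulrS -?exprS //.
elim: n {IH} => [|n IH]; last by rewrite mulrS exprS filt_geM.
by rewrite mulr0n expr0; have /andP[] := hone_proof v F R.
Qed.

End GradedComponents.

Section GradedMapComponents.
Variables (F F' : divringClosed L) (R R' : subringClosed L).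
Hypotheses (sFF' : {subset F <= F'}) (sRR' : {subset R <= R'}).

Lemma gcomp_map (s : gr v F R) g :
  gcomp (gr_map F' R' s) g - gcomp s g \in val_gt v g.
Proof.
rewrite -{1}[s]reprK (gr_map_pi sFF' sRR' (repr s)) /gcomp.
by rewrite -(hcomp_lift sFF' sRR' (repr s)); apply: gcomp_pi.
Qed.

Lemma gr_map_cls g a : g \in vgroup v F -> a \in filt_ge v R g ->
  gr_map F' R' (gr_cls v F R g a) = gr_cls v F' R' g a.
Proof.
move=> Fg Ra; have ha : (g \in vgroup v F) && (a \in filt_ge v R g) by rewrite Fg.
have hp : (g \in vgroup v F') && (a \in filt_ge v R' g).
  have /asboolP[x /andP[Fx x0] vx] := Fg; have /andP[Ra' va] := Ra.
  apply/andP; split; last by apply/andP; rewrite sRR'.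
  by apply/asboolP; exists x => //; rewrite sFF'.
rewrite (gr_clsE ha) (gr_map_pi sFF' sRR') (gr_clsE hp) /hterms_lift /= insubT.
by congr gr_pi; congr [:: _]; apply: val_inj.
Qed.

End GradedMapComponents.
End ValuationTheory.

(** * The monomial basis of gr(S) over gr(R) *)

Section MonomialBasis.
Variables (L : fieldType) (G : oagType) (v : valuation L G) (K : divringClosed L).
Variables (e f : nat) (x : L) (s : 'I_f -> L).
Hypothesis x0 : x != 0.
Hypothesis x_indep : forall i j : 'I_e, v x *+ i - v x *+ j \in vgroup v K -> i = j.
Hypothesis s_ge0 : forall j, s j \in val_ge v 0.
Hypothesis s_indep : forall c : 'I_f -> L, (forall j, c j \in vring v K) ->
  \sum_j c j * s j \in val_gt v 0 -> forall j, c j \in val_gt v 0.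

Implicit Types (a : 'I_e * 'I_f -> L) (g : G).

Let xn0 n : x ^+ n != 0. Proof. exact: expf_neq0. Qed.

(* Terms with different exponents of x have values in different cosets of the *)
(* value group of K, so no cancellation occurs between them; for a fixed      *)
(* exponent, cancellation is excluded by the residues of the s j.             *)
Lemma monomial_indep_gt a g : (forall p, a p \in K) ->
  (forall p, a p * x ^+ p.1 \in val_ge v g) ->
  \sum_p a p * (s p.2 * x ^+ p.1) \in val_gt v g ->
  forall p, a p * x ^+ p.1 \in val_gt v g.
Proof.
move=> aK age sum_gt [i0 j0]; apply/negPn/negP => /= ngt.
have [b0 vb] := val_ge_exact (age (i0, j0)) ngt; rewrite /= in b0 vb.
set b := a (i0, j0) * x ^+ i0 in b0 vb.
have a0 : a (i0, j0) != 0 by apply: contraNneq b0 => a00; rewrite /b a00 mul0r.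
(* A term of value exactly g in another row i would put the difference of the values of x^i and x^i0
   into the value group of K. *)
have gt_i i : i != i0 -> \sum_j a (i, j) * (s j * x ^+ i) \in val_gt v g.
  move=> ii0; apply: val_gt_sum => j _; rewrite mulrCA -[g]add0r addrC mulrC.
  apply: val_gtM (s_ge0 j); apply/negPn/negP => nij.
  have [c0 vc] := val_ge_exact (age (i, j)) nij; rewrite /= in c0 vc.
  have aij0 : a (i, j) != 0 by apply: contraNneq c0 => ->; rewrite mul0r.
  case/negP: ii0; apply/eqP; apply: x_indep.
  have : v x *+ i - v x *+ i0 = v (a (i0, j0) / a (i, j)).
    rewrite val_mul ?invr_eq0 // valV // -!val_exp //.
    apply/eqP; rewrite subr_eq addrAC eq_sym subr_eq -!val_mul // vb.
    by rewrite mulrC vc.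
  move=> ->; apply/asboolP; exists (a (i0, j0) / a (i, j)) => //.
  by rewrite rpred_div ?aK //= mulf_neq0 ?invr_eq0.
have sum_i0 : \sum_j a (i0, j) * (s j * x ^+ i0) \in val_gt v g.
  have sumE : \sum_p a p * (s p.2 * x ^+ p.1) = \sum_i \sum_j a (i, j) * (s j * x ^+ i).
    by rewrite pair_bigA /=; apply: eq_bigr => -[].
  move: sum_gt; rewrite sumE (bigD1 i0) //= => sum_gt.
  rewrite -[X in X \in _](addrK (\sum_(i < e | i != i0) \sum_j a (i, j) * (s j * x ^+ i))).
  by apply: val_gtB => //; apply: val_gt_sum.
(* Dividing row i0 by [b], whose value is g, gives a relation among the s_j with coefficients in
   V_nu, the one at j0 being 1. This contradicts [s_indep]. *)
have b_inv : b^-1 \in val_ge v (- g) by rewrite -vb -valV // val_ge_refl.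
have c_ge j : a (i0, j) / a (i0, j0) \in vring v K.
  apply/andP; split; first by rewrite rpred_div.
  rewrite -[X in val_ge v X](subrr g) (_ : _ / _ = a (i0, j) * x ^+ i0 / b).
    by apply: val_geM (age (i0, j)) b_inv.
  by rewrite /b -mulf_div divff ?mulr1.
have c_gt : \sum_j a (i0, j) / a (i0, j0) * s j \in val_gt v 0.
  rewrite -(subrr g) (_ : \sum_j _ = (\sum_j a (i0, j) * (s j * x ^+ i0)) / b).
    exact: val_gtM.
  rewrite mulr_suml; apply: eq_bigr => j _.
  by rewrite /b mulrA -mulf_div divff ?mulr1 // mulrAC.
have := s_indep c_ge c_gt j0.
by rewrite divff // -topredE /= /val_gt oner_eq0 /= Defs.val1 ltxx.
Qed.

(** If some term had value below g, take the least such value: every term has at least this value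
    and the sum has a larger one, so [monomial_indep_gt] at this value is contradicted by the
    minimal term. *)
Lemma monomial_indep_ge a g : (forall p, a p \in K) ->
  \sum_p a p * (s p.2 * x ^+ p.1) \in val_ge v g ->
  forall p, a p * x ^+ p.1 \in val_ge v g.
Proof.
move=> aK sum_ge p0; apply/negPn/negP => np0.
have [p np pm] := oag_argmin (P := fun p => a p * x ^+ p.1 \notin val_ge v g)
  (fun p => v (a p * x ^+ p.1)) np0.
have lt_g : v (a p * x ^+ p.1) < g.
  by move: np; rewrite -topredE /= /val_ge negb_or oag_ltNge => /andP[].
have b0 : a p * x ^+ p.1 != 0 by apply: contraNneq np => ->; apply: val_ge0.
suff all_ge q : a q * x ^+ q.1 \in val_ge v (v (a p * x ^+ p.1)).
  have := monomial_indep_gt aK all_ge (val_ge_lt lt_g sum_ge) p.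
  by rewrite -topredE /= /val_gt (negPf b0) ltxx.
have [q_ge|q_nge] := boolP (a q * x ^+ q.1 \in val_ge v g).
  exact: val_ge_le (ltW lt_g) q_ge.
exact: val_ge_le (pm q q_nge) (val_ge_refl _ _).
Qed.

Variables (R S : localSubring L).
Hypotheses (sRK : {subset R <= K}) (sRS : {subset R <= S}).
Hypotheses (xS : x \in S) (sS : forall j, s j \in S).

Let gS := gr v (whole L) S.
Let gmap : gr v K R -> gS := gr_map (whole L) S.
Let sub_whole : {subset K <= whole L}. Proof. by []. Qed.

Lemma vgroup_whole g : g \in vgroup v (whole L).
Proof. by apply/asboolP; have [z z0 vz] := val_surj v g; exists z => //; rewrite z0. Qed.

(** Kept as a product, this agrees with the family used in [tensor_presentation]; [gr_monomialE]
    rewrites it as one homogeneous class. *)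
Definition gr_monomial (p : 'I_e * 'I_f) : gS :=
  gr_cls v (whole L) S 0 (s p.2) * gr_cls v (whole L) S (v x) x ^+ p.1.

Lemma gr_monomialE p :
  gr_monomial p = gr_cls v (whole L) S (v x *+ p.1) (s p.2 * x ^+ p.1).
Proof.
have xf : x \in filt_ge v S (v x) by apply/andP; rewrite xS val_ge_refl.
rewrite /gr_monomial gr_clsX ?vgroup_whole // -gr_clsM ?add0r ?vgroup_whole //.
  by apply/andP; rewrite sS s_ge0.
by apply/andP; rewrite rpredX // val_ge_exp ?val_ge_refl.
Qed.

Lemma gr_monomial_filt (p : 'I_e * 'I_f) : s p.2 * x ^+ p.1 \in filt_ge v S (v x *+ p.1).
Proof.
apply/andP; rewrite rpredM ?rpredX // -[_ *+ _]add0r val_geM ?s_ge0 //.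
by rewrite val_ge_exp ?val_ge_refl.
Qed.

(** In each degree h the relation says that a monomial sum with coefficients in R has value above h.
    By [monomial_indep_gt] every single term then does, so every component of every coefficient
    vanishes. *)
Lemma gr_monomial_free (c : 'I_e * 'I_f -> gr v K R) :
  \sum_p gmap (c p) * gr_monomial p = 0 -> forall p, c p = 0.
Proof.
move=> sum0.
(* The monomial p has degree i times the value of x, so only this component of [c p] contributes to
   degree h. *)
pose a h (p : 'I_e * 'I_f) := gcomp (c p) (h - v x *+ p.1).
have aR h p : a h p \in R by have /andP[] := gcompP (c p) (h - v x *+ p.1).
have a_ge h p : a h p \in val_ge v (h - v x *+ p.1).
  by have /andP[] := gcompP (c p) (h - v x *+ p.1).
have a_gt h : \sum_p a h p * (s p.2 * x ^+ p.1) \in val_gt v h.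
  have := gcomp_sum (index_enum _) xpredT (fun p => gmap (c p) * gr_monomial p) h.
  rewrite sum0 => sum_gt; have := val_gtB (gcomp0 v (whole L) S h) sum_gt.
  rewrite opprB addrC subrK => {}sum_gt.
  rewrite -[X in X \in _](subrK (\sum_p gcomp (gmap (c p) * gr_monomial p) h)).
  apply: val_gtD => //; rewrite -val_gtN opprB -sumrB.
  apply: val_gt_sum => p _; rewrite gr_monomialE.
  rewrite -(subrKA (gcomp (gmap (c p)) (h - v x *+ p.1) * (s p.2 * x ^+ p.1))).
  apply: val_gtD.
    by apply: gcompM_cls; [apply: vgroup_whole|apply: gr_monomial_filt].
  rewrite -mulrBl -[in val_gt v h](subrK (v x *+ p.1) h).
  apply: val_gtM; first by apply: gcomp_map.
  by have /andP[] := gr_monomial_filt p.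
have a_gt' h p : a h p * x ^+ p.1 \in val_gt v h.
  apply: monomial_indep_gt => // q; first exact: sRK.
  rewrite -[in val_ge v h](subrK (v x *+ q.1) h).
  by rewrite val_geM ?a_ge ?val_ge_exp ?val_ge_refl.
move=> p; apply: gcomp_eq => g.
apply: val_gtB; last exact: gcomp0.
(* This degree is chosen so that the shift cancels and [a] is the component of [c p] in degree g. *)
have := a_gt' (g + v x *+ p.1) p; rewrite /a addrK => ap.
have inv_ge : (x ^+ p.1)^-1 \in val_ge v (- (v x *+ p.1)).
  by rewrite -val_exp // -valV // val_ge_refl.
by have := val_gtM ap inv_ge; rewrite mulfK ?addrK.
Qed.

Hypothesis approx : forall z g, z \in S -> exists a,
  [/\ forall p, a p \in R & z - \sum_p a p * (s p.2 * x ^+ p.1) \in filt_gt v S g].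

(** A class of degree g is represented by a monomial sum approximating z beyond g. Since values do
    not cancel, all its terms have value at least g, and those of value exactly g give the
    expansion. *)
Lemma gr_monomial_span (z : gS) : exists c : 'I_e * 'I_f -> gr v K R,
  z = \sum_p gmap (c p) * gr_monomial p.
Proof.
elim/gr_ind: z => [|z t [c ->] [d ->]|g z _ /andP[Sz vz]].
- exists (fun=> 0); rewrite big1 // => p _.
  have /eqP := gr_map_zmod sub_whole sRS (0 : gr v K R) 0.
  by rewrite subrr subrr => /eqP; rewrite /gmap => ->; rewrite mul0r.
- exists (fun p => c p + d p); rewrite -big_split /=; apply: eq_bigr => p _.
  rewrite -mulrDl; congr (_ * _); apply/eqP; rewrite eq_sym /gmap.
  have h := gr_map_zmod sub_whole sRS (c p + d p) (d p).
  by rewrite addrK in h; rewrite -subr_eq -h.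
have [a [aR approx_a]] := approx g Sz.
have sum_ge : \sum_p a p * (s p.2 * x ^+ p.1) \in val_ge v g.
  rewrite -[X in X \in _](subKr z) val_geD // val_geN val_gtW //.
  by case/andP: approx_a.
have a_ge := monomial_indep_ge (fun p => sRK (aR p)) sum_ge.
have t_ge p : a p * (s p.2 * x ^+ p.1) \in filt_ge v S g.
  apply/andP; split; first by rewrite !rpredM ?rpredX // sRS.
  by rewrite mulrCA -[g]add0r val_geM.
(* Terms of value above g vanish in degree g. The test also covers [a p = 0], where [v (a p)] has no
   meaning. *)
exists (fun p => if a p * x ^+ p.1 \in val_gt v g then 0
                 else gr_cls v K R (v (a p)) (a p)).
rewrite (@gr_cls_eq _ _ _ (whole L) S g z (\sum_p a p * (s p.2 * x ^+ p.1))) //; last 3 first.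
- exact: vgroup_whole.
- by apply/andP.
- apply/andP; split=> //; apply: rpred_sum => p _.
  by have /andP[] := t_ge p.
rewrite gr_cls_sum ?vgroup_whole //; apply: eq_bigr => p _.
case: ifPn => [gt|ngt].
  rewrite gr_cls0 ?vgroup_whole //; last first.
    apply/andP; split; first by have /andP[] := t_ge p.
    by rewrite mulrCA -[g]addr0 mulrC val_gtM.
  have := gr_map_zmod sub_whole sRS (0 : gr v K R) 0.
  by rewrite subrr subrr /gmap => ->; rewrite mul0r.
have [b0 vb] := val_ge_exact (a_ge p) ngt.
have a0 : a p != 0 by apply: contraNneq b0 => ->; rewrite mul0r.
have Ka : v (a p) \in vgroup v K by apply/asboolP; exists (a p); rewrite ?sRK.
have af : a p \in filt_ge v R (v (a p)) by apply/andP; rewrite aR val_ge_refl.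
have af' : a p \in filt_ge v S (v (a p)) by apply/andP; rewrite sRS ?val_ge_refl.
rewrite /gmap gr_map_cls // gr_monomialE -gr_clsM ?vgroup_whole ?gr_monomial_filt //.
by congr gr_cls; rewrite -vb val_mul // val_exp.
Qed.

End MonomialBasis.

(** * Spanning and the universal property of the tensor product *)

Section TensorLift.
Variables (k : fieldType) (A B C : comNzRingType).
Variables (f : {rmorphism k -> A}) (g : {rmorphism k -> B}).
Local Notation T := (tensor f g).

Lemma tensD a a' b : tens f g (a + a') b = tens f g a b + tens f g a' b.
Proof. by rewrite sumRingD; apply/sumRingP; apply: TensDl. Qed.

Lemma tens0l b : tens f g 0 b = 0.
Proof. by apply/sumRingP; apply: Tens0. Qed.

Lemma tensDr a b b' : tens f g a (b + b') = tens f g a b + tens f g a b'.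
Proof. by rewrite sumRingD; apply/sumRingP; apply: TensDr. Qed.

Lemma tensZ c a b : tens f g (f c * a) b = tens f g a (g c * b).
Proof. by apply/sumRingP; apply: TensZ. Qed.

Lemma tens0r a : tens f g a 0 = 0.
Proof. by apply: (addrI (tens f g a 0)); rewrite -tensDr !addr0. Qed.

Lemma tens_sumr (I : Type) (r : seq I) (F : I -> B) a :
  tens f g a (\sum_(i <- r) F i) = \sum_(i <- r) tens f g a (F i).
Proof. by elim: r => [|i r IH]; rewrite ?(big_nil, big_cons) ?tens0r // tensDr IH. Qed.

Lemma tensor_ind (P : T -> Prop) : P 0 -> (forall s t, P s -> P t -> P (s + t)) ->
  (forall a b, P (tens f g a b)) -> forall t, P t.
Proof.
move=> P0 PD Pt; elim/quotW => s; elim: s => [//|[a b] s IH].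
by have := PD _ _ (Pt a b) IH; rewrite sumRingD.
Qed.

Lemma tensor_span (I : finType) (s : I -> B) : (forall b, in_span g s b) ->
  forall t : T, exists a : I -> A, t = \sum_j tens f g (a j) (s j).
Proof.
move=> sp; elim/tensor_ind => [|t t' [a ->] [a' ->]|a b].
- by exists (fun=> 0); rewrite big1 // => j _; rewrite tens0l.
- exists (fun j => a j + a' j); rewrite -big_split; apply: eq_bigr => j _.
  by rewrite tensD.
have [c ->] := sp b; exists (fun j => f (c j) * a); rewrite tens_sumr.
by apply: eq_bigr => j _; rewrite tensZ.
Qed.

Variables (f' : {rmorphism A -> C}) (g' : {rmorphism B -> C}).
Hypothesis fg : forall c, f' (f c) = g' (g c).

Lemma tensor_lift : exists tau : {rmorphism T -> C},
  forall a b, tau (tens f g a b) = f' a * g' b.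
Proof.
pose F (s : seq (A * B)) := \sum_(p <- s) f' p.1 * g' p.2.
have FE s t : tens_eq f g s t -> F s = F t.
  elim=> {s t} [s t _|s t r _ ->|s t st|s t r _ IH|b|a a' b|a b b'|c a b] //.
  - exact: perm_big.
  - by rewrite /F !big_cat /= -/(F s) IH.
  - by rewrite /F big_cons !big_nil rmorph0 mul0r addr0.
  - by rewrite /F !big_cons !big_nil !addr0 rmorphD mulrDl.
  - by rewrite /F !big_cons !big_nil !addr0 rmorphD mulrDr.
  - by rewrite /F !big_cons !big_nil !addr0 !rmorphM fg mulrCA mulrA.
pose tau (t : T) := F (repr t).
have tauE s : tau (\pi_(sumRing (tens_cong f g)) s) = F s.
  by apply: FE; apply: (@repr_sc _ (tens_cong f g)).
have tauD : {morph tau : s t / s + t}.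
  elim/quotW=> s; elim/quotW=> t; rewrite sumRingD !tauE.
  by rewrite /F big_cat.
have tau0 : tau 0 = 0 by rewrite -[0](sumRing0 (tens_cong f g)) tauE /F big_nil.
have tauZ : zmod_morphism tau.
  by move=> s t; apply/eqP; rewrite eq_sym subr_eq -tauD subrK.
have tauM : monoid_morphism tau.
  split; first by rewrite -[1](sumRing1 (tens_cong f g)) tauE /F big_seq1 !rmorph1 mulr1.
  elim/quotW=> s; elim/quotW=> t; rewrite sumRingM !tauE /F big_allpairs_dep /=.
  rewrite mulr_suml; apply: eq_bigr => p _; rewrite mulr_sumr.
  by apply: eq_bigr => q _; rewrite !rmorphM mulrACA.
pose m := HB.pack_for {rmorphism T -> C} tau
  (GRing.isZmodMorphism.Build T C tau tauZ) (GRing.isMonoidMorphism.Build T C tau tauM).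
by exists m => a b; rewrite [LHS]tauE /F big_seq1.
Qed.
End TensorLift.

(** * Presentation of a free extension generated by an e-th root *)

Section QuotientPresentation.
Variables (T B : comNzRingType) (tau : {rmorphism T -> B}) (xi : B) (c : T) (e : nat).
Hypotheses (e_gt0 : (0 < e)%N) (xi_e : xi ^+ e = tau c).
Let h : {poly T} := 'X^e - c%:P.

(** Evaluation at xi kills h, hence factors through the quotient. Remainders have degree below e, so
    freeness gives injectivity and spanning gives surjectivity; [phi] is the inverse of this
    evaluation. *)
Lemma qpoly_presentation :
  free_over tau (fun i : 'I_e => xi ^+ i) ->
  (forall z, in_span tau (fun i : 'I_e => xi ^+ i) z) ->
  exists phi : {rmorphism B -> {poly %/ h}},
    bijective phi /\ forall t, phi (tau t) = in_qpoly h t%:P.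
Proof.
move=> free span.
have size_h : size h = e.+1 by rewrite size_XnsubC.
have monic_h : h \is monic by rewrite monicXnsubC.
(* The quotient type divides by [mk_monic h], which is h itself because h is monic of degree e >
   0. *)
have mk_h : mk_monic h = h by rewrite /mk_monic size_h ltnS e_gt0 monic_h.
pose ev (p : {poly T}) := (map_poly tau p).[xi].
have evh : ev h = 0.
  by rewrite /ev rmorphB /= map_polyXn map_polyC !hornerE xi_e subrr.
have evM p q : ev (p * q) = ev p * ev q by rewrite /ev rmorphM hornerM.
have evD p q : ev (p + q) = ev p + ev q by rewrite /ev rmorphD hornerD.
have ev_rmod p : ev (Pdiv.CommonRing.rmodp p (mk_monic h)) = ev p.
  rewrite mk_h [p in RHS](Pdiv.RingMonic.rdivp_eq monic_h p).
  by rewrite evD evM evh mulr0 add0r.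
have ev_mod p : ev (in_qpoly h p) = ev p by rewrite /in_qpoly /= ev_rmod.
have size_q (q : {poly %/ h}) : (size (q : {poly T}) <= e)%N.
  by rewrite -ltnS; apply: leq_trans (size_mk_monic q) _; rewrite mk_h size_h.
have ev_sum (q : {poly %/ h}) : ev q = \sum_(i < e) tau q`_i * xi ^+ i.
  rewrite /ev (@horner_coef_wide _ e) ?(leq_trans (size_poly _ _)) //.
  by apply: eq_bigr => i _; rewrite coef_map.
pose psi (q : {poly %/ h}) := ev q.
have psiD : {morph psi : p q / p + q} by move=> p q; rewrite /psi poly_of_qpolyD evD.
have psiM : {morph psi : p q / p * q}.
  by move=> p q; rewrite /psi poly_of_qpolyM ev_rmod evM.
have psi_inj : injective psi.
  move=> p q pq; apply/npolyP => i; have [ie|ei] := ltnP i e; last first.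
    by rewrite !nth_default // (leq_trans _ ei).
  move: pq; rewrite /psi !ev_sum => pq.
  exact: (free_over_inj (c := fun i : 'I_e => p`_i) (d := fun i : 'I_e => q`_i)
    free pq (Ordinal ie)).
have psi_surj z : exists q, psi q = z.
  have [a ->] := span z; exists (in_qpoly h (\sum_i a i *: 'X^i)).
  rewrite /psi ev_mod /ev rmorph_sum horner_sum; apply: eq_bigr => i _.
  by rewrite /= map_polyZ map_polyXn !hornerE.
have [phi phiK] := choice psi_surj.
have psiK : cancel psi phi by move=> q; apply: psi_inj; rewrite phiK.
have phiZ : zmod_morphism phi.
  move=> p q; apply: psi_inj; apply: (addIr (psi (phi q))).
  by rewrite -[RHS]psiD subrK !phiK subrK.
have phiM : monoid_morphism phi.
  split; last by move=> p q; apply: psi_inj; rewrite psiM !phiK.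
  by apply: psi_inj; rewrite phiK /psi -in_qpoly1 ev_mod /ev rmorph1 hornerC.
pose m := HB.pack_for {rmorphism B -> {poly %/ h}} phi
  (GRing.isZmodMorphism.Build B {poly %/ h} phi phiZ)
  (GRing.isMonoidMorphism.Build B {poly %/ h} phi phiM).
exists m; split; first by exists psi.
by move=> t; apply: psi_inj; rewrite [LHS]phiK /psi ev_mod /ev map_polyC hornerC.
Qed.
End QuotientPresentation.

(** * Generation of S over R and approximation by monomial sums *)

Section Domination.
Variables (L : fieldType) (G : oagType) (v : valuation L G).
Implicit Types R S : localSubring L.

Lemma dom_ge0 S z : dominates (vring v (whole L)) S -> z \in S -> z \in val_ge v 0.
Proof. by move=> d Sz; have /andP[] := d.1 _ Sz. Qed.

Lemma dom_gt0 S z : dominates (vring v (whole L)) S -> z \in max_ideal S -> z \in val_gt v 0.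
Proof. by move=> d; rewrite -d.2 mx_vring => /andP[/andP[]]. Qed.

(* If the maximal ideal is generated by y, then a nonzero prime not           *)
(* containing y consists of multiples of all powers of y, contradicting the   *)
(* archimedean property.                                                      *)
Lemma principal_no_chain S y : rational_group G ->
  dominates (vring v (whole L)) S -> y \in max_ideal S ->
  (forall z, z \in max_ideal S -> exists2 b, b \in S & z = b * y) ->
  ~ exists P : nat -> prime_idealr (subr S), prime_chain 2 P.
Proof.
move=> rat d my mS [P chain].
have [_ nP10] := chain 0 isT; have [sP12 nP21] := chain 1 isT.
have P2max (q : subr S) : q \in P 2 -> val q \in max_ideal S.
  move=> qP; apply/asboolP; exists q => //; apply/nonunitsP => -[b bq].
  by have := idealr1 (P 2); rewrite -bq idealMr.
have [p pP1 pP0] : exists2 p, p \in P 1 & p \notin P 0.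
  apply: contrapT => n; apply: nP10 => p pP1; apply/negPn/negP => pP0.
  by apply: n; exists p.
have [q qP2 qP1] : exists2 q, q \in P 2 & q \notin P 1.
  apply: contrapT => n; apply: nP21 => r rP2; apply/negPn/negP => rP1.
  by apply: n; exists r.
have Sy : y \in S by have /mxP[] := my.
pose y' := mk_subr Sy.
have mulP (r : subr S) : val r \in max_ideal S -> exists b : subr S, r = b * y'.
  by move=> /mS[b Sb rE]; exists (mk_subr Sb); apply: val_inj.
(* As q is a multiple of y, having y in [P 1] would force q into [P 1]. *)
have y'P1 : y' \notin P 1.
  by apply: contra qP1 => yP; have [b ->] := mulP q (P2max _ qP2); apply: idealMr.
have div n : exists2 b, b \in P 1 & p = b * y' ^+ n.
  elim: n => [|n [b bP1 ->]]; first by exists p; rewrite ?mulr1.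
  have [b' bE] := mulP b (P2max _ (sP12 _ bP1)).
  exists b'; last by rewrite bE exprS mulrA.
  by move: bP1; rewrite bE prime_idealrM (negPf y'P1) orbF.
have p0 : val p != 0.
  apply: contraNneq pP0 => p0; rewrite (_ : p = 0) ?idealr0 //; exact: val_inj.
have y0 : y != 0.
  have [b _ pE] := div 1%N; apply: contraNneq p0 => y0.
  by rewrite pE /= y0 mulr0.
have vy : 0 < v y by have := dom_gt0 d my; rewrite -topredE /= /val_gt (negPf y0).
have [n] := rational_archimedean (v (val p)) rat vy.
have [b _ pE] := div n.
have pv : val p = val b * y ^+ n.
  by rewrite pE rmorphM rmorphXn.
have b0 : val b != 0 by apply: contraNneq p0 => b0; rewrite pv b0 mul0r.
rewrite pv val_mul ?expf_neq0 // val_exp // oag_ltNge -{1}[v y *+ n]add0r oag_leD2rE.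
by have := dom_ge0 d (valP b); rewrite -topredE /= /val_ge (negPf b0) /= => ->.
Qed.

(** If x were 0, then y alone would generate the maximal ideal, which dimension two excludes by
    [principal_no_chain]. *)
Lemma regular_parameter_neq0 S x y : rational_group G ->
  dominates (vring v (whole L)) S -> regular_parameters S x y -> x != 0.
Proof.
move=> rat d [[_ _ [chain _] _] mS]; apply/eqP => x0.
apply: (principal_no_chain (y := y) rat d _ _ chain).
  by apply/mS; exists 0, 1; rewrite rpred0 rpred1 mul0r mul1r add0r.
by move=> z /mS[a [b [_ Sb ->]]]; exists b => //; rewrite x0 mulr0 add0r.
Qed.

(** As gamma is a unit, u and w generate the ideal (x^e, y) of S. Modulo y, an element of S is
    expanded in powers of x, each coefficient being reduced modulo m_S = (x, y) to a combination of
    the s_j over R. *)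
Lemma monomial_generation R S (x y u w gamma : L) (e f : nat) (s : 'I_f -> L) :
  x \in S -> unit_in S gamma -> u = gamma * x ^+ e -> w = y ->
  (forall z, z \in max_ideal S <-> exists a b, [/\ a \in S, b \in S & z = a * x + b * y]) ->
  (forall j, s j \in S) ->
  (forall z, z \in S -> exists c : 'I_f -> L,
     (forall j, c j \in R) /\ z - \sum_j c j * s j \in max_ideal S) ->
  forall z, z \in S -> exists (a : 'I_e * 'I_f -> L) r1 r2,
    [/\ forall p, a p \in R, r1 \in S, r2 \in S
      & z = \sum_p a p * (s p.2 * x ^+ p.1) + u * r1 + w * r2].
Proof.
move=> xS [_ gamma0 gammaV] uE wE mS sS res_span z Sz.
(* Induction on e is possible once u is replaced by x^e; the unit is absorbed into [r1]. Indexing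
   [a] by all of nat lets it be extended at each step. *)
suff [a [r1 [r2 [aR r1S r2S zE]]]] : exists (a : nat -> 'I_f -> L) r1 r2,
    [/\ forall i j, a i j \in R, r1 \in S, r2 \in S
      & z = \sum_(i < e) \sum_j a i j * (s j * x ^+ i) + x ^+ e * r1 + y * r2].
  exists (fun p : 'I_e * 'I_f => a p.1 p.2), (gamma^-1 * r1), r2.
  split=> //; first by rewrite rpredM.
  by rewrite zE uE wE mulrACA divff // mul1r pair_bigA.
elim: e {uE} => [|n [a [r1 [r2 [aR r1S r2S zE]]]]].
  exists (fun _ _ => 0), z, 0; rewrite big_ord0 expr0 mul1r mulr0 addr0 add0r.
  by split=> // *; rewrite rpred0.
have [c [cR /mS[b1 [b2 [b1S b2S rE]]]]] := res_span _ r1S.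
exists (fun i j => if i == n then c j else a i j), b1, (x ^+ n * b2 + r2).
split=> // [i j||]; first by case: ifP.
  by rewrite rpredD // rpredM // rpredX.
rewrite big_ord_recr /= eqxx zE.
have -> : \sum_(i < n) \sum_j (if i == n :> nat then c j else a i j) * (s j * x ^+ i)
        = \sum_(i < n) \sum_j a i j * (s j * x ^+ i).
  by apply: eq_bigr => i _; apply: eq_bigr => j _; rewrite ltn_eqF.
move/eqP: rE; rewrite subr_eq => /eqP ->.
have -> : \sum_j c j * (s j * x ^+ n) = x ^+ n * \sum_j c j * s j.
  by rewrite mulr_sumr; apply: eq_bigr => j _; rewrite mulrA mulrC.
by rewrite exprS; ring.
Qed.

(** Apply the decomposition again to the remainders r1 and r2. Since u and w lie in R, they are
    absorbed into the coefficients, and each round raises the value of the error by at least a fixed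
    positive t. *)
Lemma approximation R S (I : finType) (m : I -> L) (u w : L) :
  rational_group G -> dominates (vring v (whole L)) S -> dominates S R ->
  u \in max_ideal R -> w \in max_ideal R -> u != 0 -> (forall p, m p \in S) ->
  (forall z, z \in S -> exists (a : I -> L) r1 r2,
    [/\ forall p, a p \in R, r1 \in S, r2 \in S
      & z = \sum_p a p * m p + u * r1 + w * r2]) ->
  forall z g, z \in S -> exists a : I -> L,
    [/\ forall p, a p \in R & z - \sum_p a p * m p \in filt_gt v S g].
Proof.
move=> rat dS dR mu mw u0 mS gen z g Sz.
have dV := dominates_trans dS dR.
(* [t] is the smaller of the values of u and w, with w = 0 counted as infinite. *)
have [t [t0 ut wt]] : exists t, [/\ 0 < t, u \in val_ge v t & w \in val_ge v t].
  have vu : 0 < v u by have := dom_gt0 dV mu; rewrite -topredE /= /val_gt (negPf u0).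
  have [wu|nwu] := boolP (w \in val_ge v (v u)).
    by exists (v u); rewrite val_ge_refl.
  move: nwu; rewrite -topredE /= /val_ge negb_or -oag_ltNge => /andP[w0 wu].
  exists (v w); rewrite val_ge_refl (val_ge_le (ltW wu)) ?val_ge_refl //.
  by have := dom_gt0 dV mw; rewrite -topredE /= /val_gt (negPf w0).
have Ru : u \in R by have /mxP[] := mu.
have Rw : w \in R by have /mxP[] := mw.
have [n gn] := rational_archimedean g rat t0.
suff [a [aR az]] : exists a : I -> L,
    (forall p, a p \in R) /\ z - \sum_p a p * m p \in val_ge v (t *+ n).
  exists a; split=> //; apply/andP; split; last exact: val_ge_lt gn az.
  by rewrite rpredB // rpred_sum // => p _; rewrite rpredM // dR.1.
elim: n z Sz {gn} => [|n IH] z Sz.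
  exists (fun=> 0); rewrite big1 => [|p _]; last by rewrite mul0r.
  by rewrite subr0 mulr0n (dom_ge0 dS) //; split=> // p; rewrite rpred0.
have [a [r1 [r2 [aR r1S r2S ->]]]] := gen z Sz.
have [a1 [a1R r1E]] := IH _ r1S; have [a2 [a2R r2E]] := IH _ r2S.
exists (fun p => a p + u * a1 p + w * a2 p); split=> [p|].
  by rewrite !rpredD ?rpredM.
rewrite (_ : _ - _ = u * (r1 - \sum_p a1 p * m p) + w * (r2 - \sum_p a2 p * m p)).
  by rewrite mulrS val_geD // val_geM.
under [X in _ - X]eq_bigr => p _ do rewrite !mulrDl -![_ * _ * m p]mulrA.
rewrite !big_split /= -!mulr_sumr !mulrBr.
set A := \sum_p _; set A1 := u * \sum_p _; set A2 := w * \sum_p _.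
by ring.
Qed.
End Domination.

(** * Adjoining an e-th root to a tensor product *)

Section TensorPresentation.
Variables (k : fieldType) (A B C : comNzRingType).
Variables (f : {rmorphism k -> A}) (g : {rmorphism k -> B}).
Variables (f' : {rmorphism A -> C}) (g' : {rmorphism B -> C}).
Hypothesis fg : forall c, f' (f c) = g' (g c).
Variables (J : finType) (s : J -> B) (e : nat) (xi : C) (a0 : A) (b0 : B).
Hypothesis s_span : forall b, in_span g s b.
Hypotheses (e_gt0 : (0 < e)%N) (xi_e : xi ^+ e = f' a0 * g' b0).
Let b (p : 'I_e * J) := g' (s p.2) * xi ^+ p.1.
Hypotheses (b_free : free_over f' b) (b_span : forall z, in_span f' b z).
Let h : {poly tensor f g} := 'X^e - (tens f g a0 b0)%:P.

Lemma tensor_presentation : exists phi : {rmorphism C -> {poly %/ h}},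
  [/\ bijective phi, forall a, phi (f' a) = in_qpoly h (tens f g a 1)%:P
    & forall b, phi (g' b) = in_qpoly h (tens f g 1 b)%:P].
(* Every tensor is a sum of a_j (x) s_j by [tensor_span]. No freeness of such sums is presupposed:
   if a combination maps to 0 in C, then [b_free] kills the a_j, so the tensor is 0. *)
Proof.
have [tau tauE] := tensor_lift fg.
have tauS (a : J -> A) (i : 'I_e) :
    tau (\sum_j tens f g (a j) (s j)) * xi ^+ i = \sum_j f' (a j) * b (i, j).
  by rewrite rmorph_sum mulr_suml; apply: eq_bigr => j _; rewrite tauE -mulrA.
have [|||phi [phi_bij phiE]] := @qpoly_presentation _ _ tau xi (tens f g a0 b0) e e_gt0.
- by rewrite tauE.
- move=> t sum0 i; have /choice[a aE] := fun i => tensor_span s_span (t i).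
  rewrite aE big1 // => j _.
  suff -> : a i j = 0 by apply: tens0l.
  apply: (b_free (c := fun p => a p.1 p.2) _ (i, j)); rewrite -[RHS]sum0.
  rewrite -(pair_bigA _ (fun i j => f' (a i j) * b (i, j))) /=.
  by apply: eq_bigr => i' _; rewrite aE tauS.
- move=> z; have [a ->] := b_span z.
  exists (fun i => \sum_j tens f g (a (i, j)) (s j)).
  under [RHS]eq_bigr => i _ do rewrite tauS.
  by rewrite pair_bigA; apply: eq_bigr => -[].
exists phi; split=> // [a|b']; rewrite -phiE tauE rmorph1 ?mulr1 //.
by rewrite mul1r.
Qed.
End TensorPresentation.

(** * Residue fields and their maps *)

Section Residues.
Variables (L : fieldType).
Implicit Types R S W : localSubring L.

Lemma res_clsD R a b : a \in R -> b \in R -> res_cls R (a + b) = res_cls R a + res_cls R b.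
Proof.
move=> Ra Rb; rewrite -[b in LHS]opprK res_clsB ?rpredN //.
by rewrite -[- b]sub0r res_clsB ?rpred0 // res_cls0 sub0r opprK.
Qed.

Lemma res_cls_sum R (I : finType) (F : I -> L) : (forall j, F j \in R) ->
  res_cls R (\sum_j F j) = \sum_j res_cls R (F j).
Proof.
move=> hF; suff [] : \sum_j F j \in R /\ res_cls R (\sum_j F j) = \sum_j res_cls R (F j) by [].
elim/big_rec2: _ => [|j b a _ [Ra <-]] /=.
  by rewrite rpred0 res_cls0.
by rewrite rpredD // res_clsD.
Qed.

Lemma res_imageP W R (d : dominates W R) z :
  z \in res_image W R <-> exists a, z = res_map d a.
Proof.
split=> [/asboolP[x Rx ->]|[a ->]]; last first.
  by apply/asboolP; exists (res_rep a); rewrite ?res_repP.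
by exists (res_cls R x); rewrite res_mapE.
Qed.

Lemma res_map_trans W S R (d : dominates W S) (d' : dominates S R) (d'' : dominates W R) a :
  res_map d (res_map d' a) = res_map d'' a.
Proof. by rewrite res_mapE ?(d'.1 _ (res_repP _)). Qed.
End Residues.

Lemma quot_eq0 (M : zmodType) (I : zmodClosed M) (z : M) :
  (\pi_(Quotient.quot I) z == 0) = (z \in I).
Proof. by rewrite -[z in RHS]subr0 Quotient.idealrBE raddf0. Qed.

(** * Consequences of stability *)

Section Stability.
Variables (L : fieldType) (K : divringClosed L) (G : oagType) (v : valuation L G).
Variables (R S : localSubring L).

Lemma dominates_vring : dominates (vring v (whole L)) (vring v K).
Proof.
split=> [z /andP[_ vz]|z]; first by apply/andP.
rewrite !mx_vring; apply/andP/andP => [[/andP[_ vz] /andP[Kz _]]|[Kz vz]] //.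
by split; [apply/andP|apply/andP; rewrite Kz val_gtW].
Qed.

Lemma dominates_vring_sub : {subset R <= K} ->
  dominates (vring v (whole L)) R -> dominates (vring v K) R.
Proof.
move=> sRK d; split=> [z Rz|z].
  by apply/andP; rewrite sRK //; have /andP[] := d.1 _ Rz.
rewrite -d.2 !mx_vring /=; case Rz: (z \in R); rewrite ?andbF // !andbT.
by rewrite sRK.
Qed.

(** The stability conditions for the trivial products of monoidal transforms. *)
Lemma stable_id (u w x y : L) e : stable v K R S ->
  dominates S R -> strongly_monomial_in R S u w x y e ->
  [/\ vgroup_iso v K x y (exponent_mx e),
      is_join (res_image (vring v (whole L)) (vring v K)) (res_image (vring v (whole L)) S) &
      linearly_disjoint (res_image (vring v (whole L)) (vring v K))
        (res_image (vring v (whole L)) S) (res_image (vring v (whole L)) R)].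
Proof. by move=> [_ st] d sm; apply: (st R S u w x y e) => //; apply: MonoidalId. Qed.

Lemma exponent_cosets (x y : L) e : vgroup_iso v K x y (exponent_mx e) ->
  forall i j : 'I_e, v x *+ i - v x *+ j \in vgroup v K -> i = j.
Proof.
move=> [phi [/bij_inj phi_inj phiE]] i j ij.
(* The class of (i - j, 0) maps to that of i - j times the value of x, which is 0. By injectivity it
   lies in the lattice of diag(e, 1), so e divides i - j, while both indices are below e. *)
pose b : 'cV[int]_2 := \col_k if k == 0 then i%:Z - j%:Z else 0.
have : \pi_(Quotient.quot (mx_lattice (exponent_mx e)^T)) b = 0.
  apply: phi_inj; rewrite phiE raddf0 !mxE /= mulr0z addr0 mulrzBr -!pmulrn.
  by apply/eqP; rewrite quot_eq0.
move/eqP; rewrite quot_eq0 => /asboolP[c /colP/(_ 0)].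
rewrite !mxE big_ord_recl big_ord1 !mxE /= mul0r addr0 => ijc.
apply: val_inj => /=.
have : (i%:Z = j%:Z %[mod e%:Z])%Z.
  by apply/eqP; rewrite eqz_mod_dvd ijc dvdz_mulr.
by rewrite !modz_nat !modn_small // => -[].
Qed.

End Stability.

(* L is the field K^*, of which k and K are subfields; v is nu^*. *)
Theorem theorem1p3 (L : fieldType) (k K : divringClosed L)
    (G : oagType) (v : valuation L G) (R S : localSubring L)
    (u w x y gamma0 : L) (e f : nat)
    (char_k : [pchar L] =i pred0)
    (sub_kK : {subset k <= K})
    (ffK : function_field k K)
    (ffL : function_field k (whole L))
    (finite_LK : exists d, has_degree K d)
    (separable_LK : forall z, separable_over K z)
    (v_trivial_k : forall c, c \in k -> c != 0 -> v c = 0)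
    (v_rational : rational_group G)
    (v_zero_dim : has_trdeg (res_image (vring v (whole L)) k) 0)
    (n_eq2 : exists d d', [/\ has_trdeg k d,
       has_trdeg (res_image (vring v (whole L)) k) d' & d = (d' + 2)%N])
    (algR : algebraic_local_ring k K R)
    (algS : algebraic_local_ring k (whole L) S)
    (domSR : dominates S R)
    (domVS : dominates (vring v (whole L)) S)
    (stableRS : stable v K R S)
    (index_e : vgroup_index v K e)
    (degree_f : has_degree (res_image (vring v (whole L)) (vring v K)) f)
    (params_R : regular_parameters R u w)
    (params_S : regular_parameters S x y)
    (gamma0_unit : unit_in S gamma0)
    (u_eq : u = gamma0 * x ^+ e)
    (w_eq : w = y) :
  let grR := gr v K R in
  let grS := gr v (whole L) S in
  let T := gr_tensor K domVS domSR in
  let c : T := gr_tens domVS domSR (initial_form v K R u) (res_cls S gamma0)^-1 in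
  let h := 'X^e - c%:P in
  (exists phi : {rmorphism grS -> {poly %/ h}},
     [/\ bijective phi,
         forall a : grR, phi (gr_map (whole L) S a)
           = in_qpoly h (gr_tens domVS domSR a 1)%:P &
         forall b : res S, phi (gr_res (whole L) domVS b)
           = in_qpoly h (gr_tens domVS domSR 1 b)%:P]) /\
  has_degree (frac_image (gr_map (whole L) S : grR -> grS)) (e * f).
Proof.
move=> grR grS T c h.
have domVR := dominates_trans domVS domSR.
have sRS := domSR.1.
have sRK : {subset R <= K}.
  move=> z Rz; apply/(algR.2 z); exists z, 1.
  by rewrite Rz rpred1 oner_neq0 divr1.
have dVV : dominates (vring v (whole L)) (vring v K) := dominates_vring K v.
have dVR : dominates (vring v K) R := dominates_vring_sub sRK domVR.
(* The quotient of the value groups contains the class of 0, so its order is not 0. *)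
have e_gt0 : (0 < e)%N.
  by have [q [q' _ _]] := index_e; case: (e) (q' 0) => // -[].
have [iso join disj] := stable_id stableRS domSR
  (And5 params_R params_S e_gt0 w_eq (ex_intro2 _ _ gamma0 gamma0_unit u_eq)).
have x_indep := exponent_cosets iso.
have [_ mR] := params_R; have [_ mS] := params_S.
have x0 : x != 0 := regular_parameter_neq0 v_rational domVS params_S.
have mu : u \in max_ideal R by apply/mR; exists 1, 0; rewrite rpred0 rpred1 mul0r mul1r addr0.
have mw : w \in max_ideal R by apply/mR; exists 0, 1; rewrite rpred0 rpred1 mul0r mul1r add0r.
have mx : x \in max_ideal S by apply/mS; exists 1, 0; rewrite rpred0 rpred1 mul0r mul1r addr0.
have Sx : x \in S by have /mxP[] := mx.
have Ru : u \in R by have /mxP[] := mu.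
have [Sg g0 Sg'] := gamma0_unit.
have u0 : u != 0 by rewrite u_eq mulf_neq0 ?expf_neq0.
have vg : v gamma0 = 0.
  apply/eqP; rewrite eq_le; apply/andP; split.
    have := dom_ge0 domVS Sg'; rewrite -topredE /= /val_ge invr_eq0 (negPf g0) /= valV // => vg'.
    by rewrite -(oag_leD2rE _ _ (- v gamma0)) subrr add0r.
  by have := dom_ge0 domVS Sg; rewrite -topredE /= /val_ge (negPf g0).
have jAB (a : res R) : res_map dVV (res_map dVR a) = res_map domVS (res_map domSR a).
  by rewrite !(res_map_trans _ _ domVR).
have CP z : z \in res_image (vring v (whole L)) R <->
    exists a, z = res_map dVV (res_map dVR a).
  rewrite (res_imageP domVR); split=> -[a ->]; exists a;
  by rewrite (res_map_trans _ _ domVR).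
(* The s_j form a basis of S/m_S over R/m_R that stays free over V_nu/m_nu; [sl] lifts them to S. *)
have [s [s_free s_span]] := join_basis jAB
  (res_imageP dVV) (res_imageP domVS) CP degree_f join disj.
pose sl j := res_rep (s j).
have sS j : sl j \in S := res_repP (s j).
have s_ge0 j : sl j \in val_ge v 0 := dom_ge0 domVS (sS j).
(* A combination of positive value reduces to a relation among the s_j over V_nu/m_nu. *)
have s_indep (a : 'I_f -> L) : (forall j, a j \in vring v K) ->
    \sum_j a j * sl j \in val_gt v 0 -> forall j, a j \in val_gt v 0.
  move=> aV sum_gt j.
  have Wa l : a l \in vring v (whole L) := dVV.1 _ (aV l).
  have Ws l : sl l \in vring v (whole L) := domVS.1 _ (sS l).
  have := s_free (fun l => res_cls (vring v K) (a l)) _ j.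
  have -> : \sum_l res_map dVV (res_cls (vring v K) (a l)) * (res_map domVS \o s) l =
      res_cls (vring v (whole L)) (\sum_l a l * sl l).
    rewrite res_cls_sum => [|l]; last by rewrite rpredM.
    by apply: eq_bigr => l _; rewrite res_mapE // res_clsM //; congr (_ * _).
  move=> s_free0; have /s_free0/eqP : res_cls (vring v (whole L)) (\sum_l a l * sl l) = 0.
    apply/eqP; rewrite -(res_cls0 (vring v (whole L))).
    rewrite res_cls_eq ?rpred0 // ?subr0 ?mx_vring // rpred_sum // => l _.
    by rewrite rpredM.
  by rewrite -(res_cls0 (vring v K)) res_cls_eq ?rpred0 // subr0 mx_vring => /andP[].
have res_span z : z \in S -> exists a : 'I_f -> L,
    (forall j, a j \in R) /\ z - \sum_j a j * sl j \in max_ideal S.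
  move=> Sz; have [a aE] := s_span (res_cls S z).
  exists (fun j => res_rep (a j)); split=> [j|]; first exact: res_repP.
  have Sa j : res_rep (a j) \in S := sRS _ (res_repP _).
  rewrite -res_cls_eq ?rpred_sum // => [|j _]; last by rewrite rpredM.
  rewrite res_cls_sum => [|j]; last by rewrite rpredM.
  rewrite aE; apply/eqP; apply: eq_bigr => j _.
  by rewrite res_clsM // /sl res_repK.
have gen := monomial_generation Sx gamma0_unit u_eq w_eq mS sS res_span.
have mnS (p : 'I_e * 'I_f) : sl p.2 * x ^+ p.1 \in S by rewrite rpredM ?rpredX.
have approx := approximation v_rational domVS domSR mu mw u0 mnS gen.
have gm_free := gr_monomial_free x0 x_indep s_ge0 s_indep sRK sRS Sx sS.
have gm_span := gr_monomial_span x0 x_indep s_ge0 s_indep sRK sRS Sx sS approx.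
have sub_whole : {subset K <= whole L} by [].
have gZ : zmod_morphism (gr_map (whole L) S : grR -> grS) by apply: gr_map_zmod.
have gM : monoid_morphism (gr_map (whole L) S : grR -> grS) by apply: gr_map_monoid.
pose gmap := HB.pack_for {rmorphism grR -> grS} (gr_map (whole L) S : grR -> grS)
  (GRing.isZmodMorphism.Build grR grS (gr_map (whole L) S : grR -> grS) gZ)
  (GRing.isMonoidMorphism.Build grR grS (gr_map (whole L) S : grR -> grS) gM).
have gm_inj : injective gmap by apply: gr_map_inj.
split; last first.
  have := has_degree_frac gm_inj gm_free gm_span.
  by rewrite card_prod !card_ord.
pose gres := gr_res (whole L) domVS : res S -> grS.
(* The two routes from R/m_R to gr(S) agree, as needed for a map out of the tensor product. *)
have gmap_res a : gmap (gr_res K (dominates_trans domVS domSR) a) = gres (res_map domSR a).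
  rewrite /gres /res_map gr_resE ?sRS ?res_repP // [LHS]gr_map_cls //.
    exact: (rpred0 (vgroup v K)).
  exact: dom_filt0 (res_repP _).
pose xi : grS := gr_cls v (whole L) S (v x) x.
have xf : x \in filt_ge v S (v x) by apply/andP; rewrite Sx val_ge_refl.
have uf : u \in filt_ge v R (v u) by apply/andP; rewrite Ru val_ge_refl.
have vu : v u \in vgroup v K by apply/asboolP; exists u; rewrite ?sRK.
(* Since gamma0 has value 0, both sides are the class of x^e = u / gamma0 in degree [v u]. *)
have xi_e : xi ^+ e = gmap (initial_form v K R u) * gres (res_cls S gamma0)^-1.
  have gammaV : (res_cls S gamma0)^-1 = res_cls S gamma0^-1.
    have gg : res_cls S gamma0 * res_cls S gamma0^-1 = 1.
      by rewrite -res_clsM // divff // res_cls1.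
    have rg0 : res_cls S gamma0 != 0.
      by apply: contra_eq_neq gg => ->; rewrite mul0r eq_sym oner_neq0.
    by apply: (mulfI rg0); rewrite divff.
  rewrite gammaV [X in _ * X](gr_resE (whole L) domVS Sg') [gmap _]gr_map_cls //.
  rewrite -gr_clsM ?vgroup_whole ?dom_filt0 //; last first.
    by apply/andP; rewrite sRS ?val_ge_refl.
  rewrite gr_clsX ?vgroup_whole // addr0 u_eq mulrAC divff // mul1r.
  by rewrite val_mul ?expf_neq0 // vg add0r val_exp.
exact: (tensor_presentation gmap_res s_span e_gt0 xi_e gm_free gm_span).
Qed.
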